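(* There exists a constant $C>0$ such that for every function $f:\Omega\to\mathbb{R}$, if $\mathcal{N}(f)$ is finite, then for every $t>0$: $$\mathbb{E}[(f_t)^2]\le C\,\frac{\mathcal{N}(f)}{\sqrt{t}}\quad\text{if } d=1,$$ $$\mathbb{E}[(f_t)^2]\le C\,\frac{\mathcal{N}(f)\ln_+(t)}{t}\quad\text{if } d=2,$$ $$\mathbb{E}[(f_t)^2]\le C\,\frac{\mathcal{N}(f)}{t}\quad\text{if } d\ge3.$$ Moreover, if $d\ge3$, then also $$\int_0^{+\infty}\mathbb{E}[(f_t)^2]\,\mathrm{d}t\le C\,\mathcal{N}(f).$$
   Context: Let $d\ge 1$. Two points $x,y\in\mathbb{Z}^d$ are neighbours ($x\sim y$) iff $\|x-y\|_2=1$; $\mathbb{B}^d$ is the set of unoriented edges between neighbours. $\Omega=(0,+\infty)^{\mathbb{B}^d}$; an element $\omega=(\omega_e)_{e\in\mathbb{B}^d}\in\Omega$ is called an environment, and $\omega_{x,y}=\omega_{y,x}=\omega_e$ for $e=(x,y)$. Translations act by $(\theta_x\,\omega)_{y,z}=\omega_{x+y,x+z}$. For fixed $\omega$, $(X_t)_{t\ge0}$ is the continuous-time Markov process on $\mathbb{Z}^d$ with jump rate $\omega_{x,y}$ between neighbours $x,y$; $\mathbf{P}^\omega_x$ is its law started from $x$ and $\mathbf{E}^\omega_x$ the corresponding expectation. $\mathbb{P}$ is a probability law on $\Omega$ (expectation $\mathbb{E}$), invariant under all $\theta_x$, $x\in\mathbb{Z}^d$, and such that $\omega_e\ge 1$ almost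 surely for every edge $e$; the walk is assumed to be well defined for all times (no explosion), almost surely. The environment viewed by the particle is $\omega(t)=\theta_{X_t}\,\omega$, and $f_t(\omega)=\mathbf{E}^\omega_0[f(\omega(t))]$. Let $B_n=\{-n,\ldots,n\}^d$, $S_n(f)=\sum_{x\in B_n}f(\theta_x\,\omega)$, and $$\mathcal{N}(f)=\sup_{n\in\mathbb{N}}\frac{1}{|B_n|}\mathbb{E}\left[(S_n(f))^2\right],$$ where $\mathbb{N}$ includes $0$. Finally $\ln_+(t)=\max(1,\ln t)$. Functions on $\Omega$ are measurable. *)

(* Defs.v *)
From HB Require Import structures.
From mathcomp Require Import all_boot all_order all_algebra finmap.
From mathcomp Require Import all_classical all_reals all_analysis.

Set Implicit Arguments.
Unset Strict Implicit.
Unset Printing Implicit Defensive.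

Import Order.TTheory GRing.Theory Num.Theory.
Import numFieldNormedType.Exports.

Local Open Scope classical_set_scope.
Local Open Scope ring_scope.

Notation Zd d := 'rV[int]_d.

(* The integer [\sum_i (x_i - y_i)^2] is the square of the Euclidean norm of
   [x - y]. *)
Definition neighbour d (x y : Zd d) : bool :=
  \sum_(i < d) (x 0 i - y 0 i) ^+ 2 == 1.

(* An unoriented edge is the set of its two endpoints. *)
Definition is_edge d (A : set (Zd d)) : Prop :=
  exists x y, neighbour x y /\ A = [set x; y].

Definition edge d := {A : set (Zd d) | is_edge A}.

Definition mk_edge d (x y : Zd d) (xy : neighbour x y) : edge d :=
  exist _ [set x; y] (ex_intro _ x (ex_intro _ y (conj xy erefl))).

Lemma neighbourDl d (x y z : Zd d) : neighbour (x + y) (x + z) = neighbour y z.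
Proof.
rewrite /neighbour; congr (_ == _); apply: eq_bigr => i _.
by rewrite !mxE opprD addrACA subrr add0r.
Qed.

Lemma shift_is_edge d (x : Zd d) (A : set (Zd d)) :
  is_edge A -> is_edge [set x + y | y in A].
Proof.
move=> [y [z [yz ->]]]; exists (x + y), (x + z); rewrite neighbourDl; split=> //.
by rewrite image_setU !image_set1.
Qed.

Definition shift_edge d (x : Zd d) (e : edge d) : edge d :=
  exist _ [set x + y | y in sval e] (shift_is_edge x (svalP e)).

Record env d (R : realType) := Env {
  weight :> edge d -> R;
  weight_gt0 : forall e, 0 < weight e }.

Section env_measurable.
Variables (d : nat) (R : realType).

HB.instance Definition _ := gen_eqMixin (env d R).
HB.instance Definition _ := gen_choiceMixin (env d R).
HB.instance Definition _ :=
  isPointed.Build (env d R) (Env (fun _ : edge d => @ltr01 R)).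

Definition cylinders : set (set (env d R)) :=
  [set C | exists (e : edge d) (A : set R),
     measurable A /\ C = [set omega : env d R | A (omega e)]].

(* The product sigma-algebra on [(0, +oo)^(edge d)]. *)
Definition Omega := g_sigma_algebraType cylinders.

End env_measurable.

Section environment.
Variables (d : nat) (R : realType).
Implicit Types (omega : Omega d R) (x y : Zd d) (f : Omega d R -> R).

(* [omega_{x,y}], extended by [0] when [x] and [y] are not neighbours. *)
Definition conductance omega x y : R :=
  match pselect (neighbour x y) with
  | left xy => weight omega (mk_edge xy)
  | right _ => 0
  end.

Definition exit_rate omega x : R :=
  \sum_(y \in [set y | neighbour x y]) conductance omega x y.

Definition theta x omega : Omega d R :=
  Env (fun e => weight_gt0 omega (shift_edge x e)).

Definition box_set n : set (Zd d) :=
  [set x | forall i, - n%:Z <= x 0 i <= n%:Z].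

Definition box n : {fset Zd d} := fset_set (box_set n).

Definition box_sum n f omega : R := \sum_(x <- box n) f (theta x omega).

Definition Nnorm (P : probability (Omega d R) R) f : \bar R :=
  ereal_sup (range (fun n : nat =>
    ((#|` box n|%:R)^-1)%:E * \int[P]_omega ((box_sum n f omega) ^+ 2)%:E)%E).

End environment.

Section walk.
Variables (d : nat) (R : realType) (dW : measure_display).
Variable W : measurableType dW.
Variable Q : Omega d R -> Zd d -> probability W R.
Variables (Y : nat -> W -> Zd d) (S : nat -> W -> R).

(* Under [Q omega x], [Y] is the discrete-time chain started at [x] which jumps
   from [y] to [z] with probability [omega_{y,z} / exit_rate omega y], and,
   given [Y], the [S i] are independent exponential variables of parameters
   [exit_rate omega (Y i)]: the law of [(Y, S)] is given on the cylinders
   [Y_0 = y_0, S_0 > s_0, ..., Y_n = y_n, S_n > s_n]. *)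
Record jump_chain_holding_times : Prop := {
  jump_chain_measurable : forall n y, measurable (Y n @^-1` [set y]);
  holding_measurable : forall n, measurable_fun [set: W] (S n);
  holding_gt0 : forall n w, 0 < S n w;
  jump_holding_law : forall (omega : Omega d R) (x : Zd d) (n : nat)
      (y : nat -> Zd d) (s : nat -> R), (forall i, 0 <= s i) ->
    Q omega x [set w | forall i, (i <= n)%N -> Y i w = y i /\ s i < S i w] =
    ((y 0 == x)%:R
     * \prod_(i < n) (conductance omega (y i) (y i.+1)
                      / exit_rate omega (y i))
     * \prod_(i < n.+1) expR (- exit_rate omega (y i) * s i))%:E }.

Definition jump_time n w : R := \sum_(i < n) S i w.

(* The continuous-time walk: [X_t = Y_n] for [T_n <= t < T_{n+1}], where [T_n] is
   the time of the [n]-th jump. The default value is only used when [t] is not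
   smaller than the explosion time [sup_n T_n]. *)
Definition walk t w : Zd d :=
  Y (xget 0%N [set n | jump_time n w <= t < jump_time n.+1 w]) w.

Definition no_explosion omega x : Prop :=
  {ae Q omega x, forall w, jump_time n w @[n --> \oo] --> +oo}.

(* [f_t(omega)]; the integral is extended-real valued, so that no value is
   assigned silently when [f (omega(t))] is not integrable. *)
Definition semigroup (f : Omega d R -> R) t omega : \bar R :=
  (\int[Q omega 0]_w (f (theta (walk t w) omega))%:E)%E.

End walk.

Definition ln_plus (R : realType) (t : R) : R := Num.max 1 (ln t).

(* The sets used in [box] and [exit_rate] are finite, so that [fset_set] and the
   finitely supported sum do not take their default values; and [theta] acts as
   expected on [conductance]. *)

Lemma finite_box_set d n : finite_set (@box_set d n).
Proof.
pose g (k : {ffun 'I_d -> 'I_(n + n).+1}) : Zd d :=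
  \row_i ((k i)%:Z - n%:Z).
apply: (@sub_finite_set _ _ (range g)); last first.
  exact/finite_image/finite_finset.
move=> x xn; exists [ffun i => inord (absz (x 0 i + n%:Z))] => //.
apply/rowP => i; have /andP[lo hi] := xn i.
have x0 : 0 <= x 0 i + n%:Z by rewrite -lerBlDr sub0r.
rewrite /g !mxE ffunE inordK ?gez0_abs ?addrK// ltnS -lez_nat gez0_abs//.
by rewrite PoszD lerD2r.
Qed.

Lemma in_box d n (x : Zd d) :
  (x \in box d n) = [forall i, - n%:Z <= x 0 i <= n%:Z].
Proof.
rewrite in_fset_set; last exact: finite_box_set.
by apply/idP/forallP; rewrite inE.
Qed.

Lemma finite_neighbours d (x : Zd d) : finite_set [set y | neighbour x y].
Proof.
apply: (@sub_finite_set _ _ [set x - y | y in @box_set d 1]); last first.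
  exact/finite_image/finite_box_set.
move=> y /eqP xy; exists (x - y); last by rewrite opprB addrC subrK.
move=> i; rewrite -ler_norml !mxE -(@expr_le1 _ 2)//.
rewrite real_normK ?num_real// -xy (bigD1 i)//= lerDl sumr_ge0// => j _.
exact: sqr_ge0.
Qed.

Lemma conductance_theta d (R : realType) (omega : Omega d R) (x y z : Zd d) :
  conductance (theta x omega) y z = conductance omega (x + y) (x + z).
Proof.
rewrite /conductance; case: pselect => yz; case: pselect => // xyz; last 2 first.
- by exfalso; apply: xyz; rewrite neighbourDl.
- by exfalso; apply: yz; rewrite -(neighbourDl x).
congr (weight omega _); apply: eq_exist => /=.
by rewrite image_setU !image_set1.
Qed.

Lemma conductanceC d (R : realType) (omega : Omega d R) (x y : Zd d) :
  conductance omega x y = conductance omega y x.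
Proof.
have C (u v : Zd d) : neighbour u v -> neighbour v u.
  move=> /eqP uv; apply/eqP; rewrite -uv; apply: eq_bigr => i _.
  by rewrite -sqrrN opprB.
rewrite /conductance; case: pselect => xy; case: pselect => // yx; last 2 first.
- by exfalso; apply/yx/C.
- by exfalso; apply/xy/C.
by congr (weight omega _); apply: eq_exist => /=; rewrite setUC.
Qed.

(* Main.v *)
(* Round the holding times up to multiples of [1/g]. The walk becomes a lazy
   discrete-time chain, whose environment chain is reversible for the weight
   [phi^-2], with [phi^2 = (1 - e^(-pi/g)) / (pi/g)] and [pi] the exit rate at
   the origin; conjugation by [phi] makes it an operator [B] which is symmetric
   on [L^2(P)], with [-1 <= B <= 1]. Since [omega_e >= 1], the Dirichlet form of
   [B] at [u] dominates [1/(2g)] times the sum of the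
   [|| T_e (phi u) - phi u ||^2], where [T_e] is the translation by the unit
   vector [e].

   If [fh = f / phi] and [u] is the sum of the [B^j fh] for [j < 2n], then
   [<fh, u>] bounds [||u||^2 / 2n], the Dirichlet form of [u] and, up to an error
   vanishing with [1/g], the sum over [j < n] of the [||B^j fh||^2], which are
   nonincreasing in [j]. Conversely [<fh, u>] is close to [<f, phi u>], which is
   split along successive averages over boxes of size [2^k]: the part at scale [k] costs
   [4^k] (Poincare) times [N(f) / 2^(kd)] against the gradients lost at that
   scale, and the gradients lost at all scales sum to at most those of [phi u].
   Hence the sum of the [4^k / 2^(kd)] over [2^k <= sqrt t] (over all [k] for
   [d >= 3]), which gives the three rates.

   The cut-off [f 1_(|f| <= M, pi <= M)] makes [f / phi] square integrable and
   the error small; Fatou's lemma is then applied in [g], then in [M]. *)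

From mathcomp Require Import all_boot all_order all_algebra finmap.
From mathcomp Require Import all_classical all_reals all_analysis measurable_realfun.
From mathcomp Require Import ring lra zify.
Require Import Defs.

Set Implicit Arguments.
Unset Strict Implicit.
Unset Printing Implicit Defensive.

Import Order.TTheory GRing.Theory Num.Theory.
Import numFieldNormedType.Exports.

Local Open Scope classical_set_scope.
Local Open Scope ring_scope.

(** * Symmetric contractions *)

(** The exit rates may be unbounded, and the generator with them, while the walk is known only
    through the cylinder probabilities of its jump chain and holding times. A step of the rounded
    chain is bounded whatever the rates, and its law is made of finite products. Positivity of 1 - B
    and 1 + B then replaces any functional calculus.

    The norm N records cancellations in box sums, which neither a cut-off nor a division by phi
    respects. So N(f) is only applied to f itself, and the cut-off function is compared with f in
    L^2 alone. This error does not decay in t: it contains the distance from f to its cut-off and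
    powers of M/g, and vanishes when g tends to infinity before M, at a fixed number of scales.

    The quantity <fh, u> is self-bounding: it dominates the Dirichlet form and the norm of u, and
    these dominate it through the splitting over scales. Weights of order g and n in Young's
    inequality let it absorb its own multiples. *)

Section semi_inner_product.
Variables (R : realFieldType) (V : lmodType R).

(** The form is only semi-definite because the elements of [L2] are functions, not classes modulo
    null sets. *)
Record semi_inner_product (dot : V -> V -> R) : Prop := {
  sdotC : forall f g, dot f g = dot g f;
  sdotDl : forall f g h, dot (f + g) h = dot f h + dot g h;
  sdotZl : forall a f h, dot (a *: f) h = a * dot f h;
  sdot_ge0 : forall f, 0 <= dot f f }.

Variable dot : V -> V -> R.
Hypothesis dotP : semi_inner_product dot.

Let dotC f g : dot f g = dot g f. Proof. exact: (sdotC dotP). Qed.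

Lemma dotDl f g h : dot (f + g) h = dot f h + dot g h.
Proof. exact: (sdotDl dotP). Qed.

Lemma dotDr f g h : dot h (f + g) = dot h f + dot h g.
Proof. by rewrite dotC dotDl !(dotC h). Qed.

Lemma dotZl a f h : dot (a *: f) h = a * dot f h.
Proof. exact: (sdotZl dotP). Qed.

Lemma dotZr a f h : dot h (a *: f) = a * dot h f.
Proof. by rewrite dotC dotZl dotC. Qed.

Lemma dotNl f h : dot (- f) h = - dot f h.
Proof. by rewrite -scaleN1r dotZl mulN1r. Qed.

Lemma dotNr f h : dot h (- f) = - dot h f.
Proof. by rewrite dotC dotNl dotC. Qed.

Lemma dot0l h : dot 0 h = 0.
Proof. by rewrite -(scale0r 0) dotZl mul0r. Qed.

Lemma dot0r h : dot h 0 = 0.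
Proof. by rewrite dotC dot0l. Qed.

Definition dotE := (dotDl, dotDr, dotNl, dotNr, dotZl, dotZr, dot0l, dot0r).

Lemma dot_suml I (s : seq I) (F : I -> V) h :
  dot (\sum_(i <- s) F i) h = \sum_(i <- s) dot (F i) h.
Proof.
by elim: s => [|i s IH]; rewrite ?(big_nil, big_cons) ?dot0l// dotDl IH.
Qed.

Lemma dot_sumr I (s : seq I) (F : I -> V) h :
  dot h (\sum_(i <- s) F i) = \sum_(i <- s) dot h (F i).
Proof. by rewrite dotC dot_suml; apply: eq_bigr => i _; rewrite dotC. Qed.

Lemma dot_young t f g : 0 < t ->
  2 * dot f g <= t * dot f f + t^-1 * dot g g.
Proof.
move=> t0; have := sdot_ge0 dotP (t *: f - g).
rewrite !dotE (dotC g f) => h.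
rewrite -(ler_pM2l t0) mulrDr mulrA mulVKf ?gt_eqF//.
nra.
Qed.

Lemma dot_sqrB f g : dot (f - g) (f - g) = dot f f - 2 * dot f g + dot g g.
Proof. by rewrite !dotE (dotC g f); ring. Qed.

Lemma dot_sqrD f g : dot (f + g) (f + g) = dot f f + 2 * dot f g + dot g g.
Proof. by rewrite !dotE (dotC g f); ring. Qed.

Lemma dot_subr_le f g : dot (f - g) (f - g) <= 2 * dot f f + 2 * dot g g.
Proof.
by have := sdot_ge0 dotP (f + g); rewrite !dotE (dotC g f) => h; nra.
Qed.

Lemma dot_addr_le f g : dot (f + g) (f + g) <= 2 * dot f f + 2 * dot g g.
Proof. by have := dot_subr_le f (- g); rewrite opprK !dotE !opprK. Qed.

(* The Cesaro-type estimates for [a k = dot f (B^k f)] which, spectrally, are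
   inequalities between polynomials on [-1, 1]. *)
Section moments.
Variable a : nat -> R.
Hypothesis a_even : forall j, a j.*2.+2 <= a j.*2.
Hypothesis a_pair0 : forall j, 0 <= a j.*2 + a j.*2.+1.
Hypothesis a_pair : forall j, a j.*2.+2 + a j.*2.+3 <= a j.*2 + a j.*2.+1.

Lemma sum_pairs (b : nat -> R) n :
  \sum_(j < n.*2) b j = \sum_(j < n) (b j.*2 + b j.*2.+1).
Proof.
elim: n => [|n IH]; first by rewrite !big_ord0.
by rewrite doubleS !big_ord_recr/= IH addrA.
Qed.

Lemma moments_pair_le i j : a (i + j).*2 + a (i + j).*2.+1 <= a j.*2 + a j.*2.+1.
Proof.
elim: i => [|i IH]; first by rewrite add0n.
by apply: le_trans IH; rewrite addSn doubleS; exact: a_pair.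
Qed.

(** Odd moments may be negative, which is why the sums have even length and are cut into pairs. For
    odd [i] the pairs are misaligned: in a(2l+1) + a(2l+2) the second term is first replaced by
    a(2l), through [a_even]. *)
Lemma moments_shift_le n i :
  \sum_(j < n.*2) a (i + j)%N <= \sum_(j < n.*2) a j.
Proof.
rewrite (sum_pairs (fun j => a (i + j)%N)) (sum_pairs a); apply: ler_sum => j _.
rewrite -[i]odd_double_half; set b := odd i; set k := i./2.
have := moments_pair_le k j; rewrite doubleD => h.
case: b; rewrite /= ?add0n// addnS; last by [].
have := a_even (k + j); rewrite doubleD add1n !addSn => h2.
by rewrite [X in X <= _]addrC; lra.
Qed.

Lemma moments_shift_ge0 n i : 0 <= \sum_(j < n.*2) a (i.*2 + j)%N.
Proof.
rewrite (sum_pairs (fun j => a (i.*2 + j)%N)); apply: sumr_ge0 => j _.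
by rewrite addnS -doubleD.
Qed.

Lemma moments_quarter_le n :
  \sum_(j < n) (a j.*2 + 2 * a j.*2.+1 + a j.*2.+2)
    <= 2 * \sum_(j < n.*2) a j.
Proof.
rewrite (sum_pairs a) mulr_sumr; apply: ler_sum => j _.
by have := a_even j; lra.
Qed.

End moments.

Section contraction.
Variable B : V -> V.
Hypothesis BD : forall f g, B (f + g) = B f + B g.
Hypothesis BZ : forall c f, B (c *: f) = c *: B f.
Hypothesis Bsym : forall f g, dot (B f) g = dot f (B g).
Hypothesis B_ge : forall f, 0 <= dot f f + dot f (B f).
Hypothesis B_le : forall f, 0 <= dot f f - dot f (B f).

Let BN f : B (- f) = - B f.
Proof. by rewrite -scaleN1r BZ scaleN1r. Qed.

Let B0 : B 0 = 0.
Proof. by have := BZ 0 0; rewrite !scale0r. Qed.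

Let itB_sum I (s : seq I) (F : I -> V) :
  B (\sum_(i <- s) F i) = \sum_(i <- s) B (F i).
Proof.
by elim: s => [|i s IH]; rewrite ?(big_nil, big_cons) ?B0// BD IH.
Qed.

Lemma iterB_sym n f g : dot (iter n B f) g = dot f (iter n B g).
Proof. by elim: n f g => // n IH f g; rewrite iterS Bsym IH -iterSr. Qed.

Lemma dot_iter i j f : dot (iter i B f) (iter j B f) = dot f (iter (i + j) B f).
Proof. by rewrite iterB_sym -iterD. Qed.

(** Adds (1 + x)^2 (1 - x) >= 0 and (1 - x)^2 (1 + x) >= 0, whose sum is 2 (1 - x^2): bounds on the
    quadratic form of [B] become a bound on its norm. *)
Lemma moment_even f : dot (B f) (B f) <= dot f f.
Proof.
have h1 := B_le (f + B f); have h2 := B_ge (f - B f).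
move: h1 h2; rewrite !BD BN !dotE !Bsym => h1 h2.
lra.
Qed.

Lemma norm_iter_le f i j : (i <= j)%N ->
  dot (iter j B f) (iter j B f) <= dot (iter i B f) (iter i B f).
Proof.
move=> /subnK <-; elim: (j - i)%N => //= k; apply: le_trans.
exact: moment_even.
Qed.

Section moments_of.
Variable f : V.
Let a k := dot f (iter k B f).

Let a_even j : a j.*2.+2 <= a j.*2.
Proof.
have := moment_even (iter j B f).
by rewrite -!iterS !dot_iter !addnS !addSn addnn.
Qed.

Let a_pair0 j : 0 <= a j.*2 + a j.*2.+1.
Proof. by have := B_ge (iter j B f); rewrite -!iterS !dot_iter addnS addnn. Qed.

Let a_pair j : a j.*2.+2 + a j.*2.+3 <= a j.*2 + a j.*2.+1.
Proof.
(* For v = (1 + B) B^j f, <v, v - B v> is the moment of x^(2j) (1 + x)^2 (1 - x), the polynomial of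
   the goal. *)
have := B_le (iter j B f + iter j.+1 B f).
rewrite BD -!iterS !dotE !dot_iter !addnS !addSn addnn -!/(a _).
lra.
Qed.

Variable n : nat.
Let u := \sum_(j < n.*2) iter j B f.

Let dotfu : dot f u = \sum_(j < n.*2) a j.
Proof. by rewrite /u dot_sumr. Qed.

(** Telescoping gives u - B u = f - B^(2n) f, and <u, B^(2n) f> is a sum of 2n moments starting at
    an even index, hence nonnegative. *)
Lemma dirichlet_partial_sum_le : dot u (u - B u) <= dot f u.
Proof.
have -> : u - B u = f - iter n.*2 B f.
  rewrite /u itB_sum -sumrB; elim: n.*2 => [|m IH]; first by rewrite big_ord0 subrr.
  by rewrite big_ord_recr/= IH addrA subrK.
rewrite dotDr dotNr [dot u f]dotC gerBl dotC /u dot_sumr.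
rewrite (_ : \sum_(_ <- _) _ = \sum_(j < n.*2) a (n.*2 + j)%N).
  exact: moments_shift_ge0.
by apply: eq_bigr => j _; rewrite dot_iter.
Qed.

(** In the double sum of the a(i + j), each of the 2n rows is a shifted window, at most the
    unshifted one. *)
Lemma norm_partial_sum_le : dot u u <= (n.*2)%:R * dot f u.
Proof.
rewrite dotfu {1}/u dot_suml.
rewrite -[X in X%:R](card_ord n.*2) -sumr_const mulr_suml.
apply: ler_sum => i _; rewrite mul1r {1}/u dot_sumr.
rewrite (_ : \sum_(_ <- _) _ = \sum_(j < n.*2) a (i + j)%N).
  exact: moments_shift_le.
by apply: eq_bigr => j _; rewrite dot_iter.
Qed.

(* Replacing [f] by [(f + B f) / 2] removes the spectrum of [B] near [-1]. *)
Lemma sum_norm_iter_le :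
  \sum_(j < n) dot (iter j B f) (iter j B f)
    <= dot f u + n%:R * dot f (f - B f).
Proof.
(* Parallelogram identity for B^j f and B^(j+1) f: the square of their sum is the bracket, that of
   their difference is at most |f - B f|^2 <= 2 <f, f - B f>. *)
have key j : dot (iter j B f) (iter j B f) <=
    2^-1 * (a j.*2 + 2 * a j.*2.+1 + a j.*2.+2) + dot f (f - B f).
  have e : dot (iter j B f) (iter j B f) = a j.*2 by rewrite dot_iter addnn.
  have b1 := norm_iter_le (f - B f) (leq0n j).
  have itB g h : iter j B (g - h) = iter j B g - iter j B h.
    by elim: (j) => //= k ->; rewrite BD BN.
  move: b1; rewrite itB -iterSr /= -/(iter j.+1 B f).
  rewrite !dotE -!/(iter j.+1 B f) !dot_iter !addnS !addSn addnn -!/(a _).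
  have := sdot_ge0 dotP (iter j.+1 B f); rewrite dot_iter addnS addSn addnn -/(a _).
  by have := moment_even f; rewrite (dotC (B f) f); lra.
rewrite dotfu; apply: (le_trans (ler_sum _ (fun (j : 'I_n) _ => key j))).
rewrite big_split/= -mulr_sumr sumr_const card_ord -[X in _ + X]mulr_natl lerD2r.
by have := moments_quarter_le a_even n; lra.
Qed.

End moments_of.
End contraction.
End semi_inner_product.

(** * Smoothing over scales *)

Section multiscale.
Variables (R : realFieldType) (V : lmodType R) (dot : V -> V -> R).
Hypothesis dotP : semi_inner_product dot.
Variables (G : zmodType) (T : G -> V -> V).
Hypothesis TD : forall x f g, T x (f + g) = T x f + T x g.
Hypothesis TZ : forall x c f, T x (c *: f) = c *: T x f.
Hypothesis TT : forall x y f, T x (T y f) = T (x + y) f.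
Hypothesis T0 : forall f, T 0 f = f.
Hypothesis Tiso : forall x f g, dot (T x f) (T x g) = dot f g.

Let dotE := dotE dotP.

Let TN x f : T x (- f) = - T x f.
Proof. by rewrite -scaleN1r TZ scaleN1r. Qed.

Let T_sum x I (s : seq I) (F : I -> V) :
  T x (\sum_(i <- s) F i) = \sum_(i <- s) T x (F i).
Proof.
elim: s => [|i s IH]; rewrite ?(big_nil, big_cons) ?TD ?IH//.
by have := TZ x 0 0; rewrite !scale0r.
Qed.

Let Tadj x f g : dot (T x f) g = dot f (T (- x) g).
Proof. by rewrite -[in LHS](T0 g) -(subrr x) -TT Tiso. Qed.

Definition average (s : seq G) f : V := (size s)%:R^-1 *: \sum_(x <- s) T x f.

Lemma averageB s f g : average s (f - g) = average s f - average s g.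
Proof.
rewrite /average -scalerBr -sumrB; congr (_ *: _).
by apply: eq_bigr => x _; rewrite TD TN.
Qed.

Lemma average_comm s x f : average s (T x f) = T x (average s f).
Proof.
rewrite /average TZ T_sum; congr (_ *: _).
by apply: eq_bigr => y _; rewrite !TT addrC.
Qed.

Let average2 s s' f : average s (average s' f) =
  ((size s)%:R^-1 * (size s')%:R^-1) *:
    \sum_(x <- s) \sum_(y <- s') T (x + y) f.
Proof.
rewrite /average -scalerA; congr (_ *: _).
rewrite [RHS]scaler_sumr; apply: eq_bigr => x _; rewrite TZ T_sum; congr (_ *: _).
by apply: eq_bigr => y _; rewrite TT.
Qed.

Lemma averageC s s' f : average s (average s' f) = average s' (average s f).
Proof.
rewrite !average2 exchange_big mulrC; congr (_ *: _).
by apply: eq_bigr => x _; apply: eq_bigr => y _; rewrite addrC.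
Qed.

Definition gradient_form (E : seq G) f :=
  \sum_(e <- E) dot (T e f - f) (T e f - f).

Section symmetric_average.
Variable s : seq G.
Hypothesis s_gt0 : (0 < size s)%N.
Hypothesis s_sym : perm_eq s [seq - x | x <- s].
Notation P := (average s).

Let m_gt0 : 0 < (size s)%:R :> R. Proof. by rewrite ltr0n. Qed.

Lemma average_sym f g : dot (P f) g = dot f (P g).
Proof.
rewrite /average (dotZl dotP) (dotZr dotP) (dot_suml dotP) (dot_sumr dotP).
congr (_ * _); rewrite [RHS](perm_big _ s_sym)/= big_map.
by apply: eq_bigr => x _; exact: Tadj.
Qed.

Lemma sum_pairs_cst (c : R) :
  (2 * (size s)%:R ^+ 2)^-1 * (\sum_(x <- s) \sum_(y <- s) c) = c / 2.
Proof.
have cst (e : R) : \sum_(y <- s) e = (size s)%:R * e.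
  by rewrite big_const_seq count_predT iter_addr_0 mulr_natl.
by rewrite !cst; field; rewrite gt_eqF.
Qed.

(** The variance identity, polarised: f = g yields contraction and the first Poincare bound, while
    [poincare_average2] takes f - P (P f) as second argument. *)
Lemma average_variance f g :
  dot f g - dot (P f) (P g) = (2 * (size s)%:R ^+ 2)^-1 *
    \sum_(x <- s) \sum_(y <- s) dot (T x f - T y f) (T x g - T y g).
Proof.
under eq_bigr do under eq_bigr do
  rewrite !dotE !Tiso opprK addrACA addrA [_ + dot f g]addrAC -!addrA.
under eq_bigr do rewrite !big_split/=.
rewrite !big_split/= !mulrDr !sum_pairs_cst.
have pp : \sum_(x <- s) \sum_(y <- s) dot (T x f) (T y g) =
    (size s)%:R ^+ 2 * dot (P f) (P g).
  rewrite /average (dotZl dotP) (dotZr dotP) (dot_suml dotP).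
  under [in RHS]eq_bigr do rewrite (dot_sumr dotP).
  by field; rewrite gt_eqF.
have N1 : \sum_(x <- s) \sum_(y <- s) - dot (T x f) (T y g) =
    - ((size s)%:R ^+ 2 * dot (P f) (P g)).
  by rewrite -pp -sumrN; apply: eq_bigr => x _; rewrite -sumrN.
have N2 : \sum_(x <- s) \sum_(y <- s) - dot (T y f) (T x g) =
    - ((size s)%:R ^+ 2 * dot (P f) (P g)).
  by rewrite exchange_big/= N1.
rewrite ?N1 ?N2.
by field; rewrite gt_eqF.
Qed.

Lemma average_norm_le f : dot (P f) (P f) <= dot f f.
Proof.
rewrite -subr_ge0 average_variance mulr_ge0// ?invr_ge0 ?mulr_ge0 ?exprn_ge0//.
by apply: sumr_ge0 => x _; apply: sumr_ge0 => y _; exact: sdot_ge0.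
Qed.

Variables (E : seq G) (K : R).
Hypothesis poincare : forall f, {in s &, forall x y,
  dot (T x f - T y f) (T x f - T y f) <= K * gradient_form E f}.

Lemma poincare_average f : dot f (f - P (P f)) <= K / 2 * gradient_form E f.
Proof.
rewrite (dotDr dotP) (dotNr dotP) -average_sym.
rewrite average_variance mulrAC -sum_pairs_cst ler_pM2l ?invr_gt0 ?mulr_gt0 ?exprn_gt0//.
rewrite big_seq [leRHS]big_seq; apply: ler_sum => x xs.
rewrite big_seq [leRHS]big_seq; apply: ler_sum => y ys.
exact: poincare.
Qed.

(* [1 - P^2] is a sum of squares of operators which commute with the
   gradients. *)
Lemma poincare_average2 f :
  dot (f - P (P f)) (f - P (P f)) <=
    K / 2 * (gradient_form E f - gradient_form E (P f)).
Proof.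
set W := fun g => g - P (P g).
have WT x g : W (T x g) = T x (W g).
  by rewrite /W !average_comm TD TN.
have WB g h : W (g - h) = W g - W h.
  by rewrite /W !averageB !opprD addrACA.
rewrite -/(W f) {1}/W (dotDl dotP) (dotNl dotP) average_sym average_variance.
apply: (@le_trans _ _ ((2 * (size s)%:R ^+ 2)^-1 *
    \sum_(x <- s) \sum_(y <- s) (K / 2 * gradient_form E (T x f - T y f)))).
  rewrite ler_pM2l ?invr_gt0 ?mulr_gt0 ?exprn_gt0//.
  apply: ler_sum => x _; apply: ler_sum => y _.
  by rewrite -!WT -WB; exact: poincare_average.
rewrite le_eqVlt; apply/orP; left; apply/eqP.
under eq_bigr do rewrite -mulr_sumr.
rewrite -mulr_sumr mulrCA; congr (_ * _).
rewrite /gradient_form -sumrB.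
under eq_bigr do rewrite exchange_big/=.
rewrite exchange_big/= mulr_sumr; apply: eq_bigr => e _.
(* The variance identity is read backwards, for the gradient of [f] along [e]: the double sum is
   what averaging removes from its square. *)
rewrite -average_comm -averageB average_variance; congr (_ * _).
apply: eq_bigr => x _; apply: eq_bigr => y _.
have -> : T e (T x f - T y f) - (T x f - T y f) =
          T x (T e f - f) - T y (T e f - f).
  by rewrite !TD !TN !TT ![e + _]addrC !opprD addrACA.
by [].
Qed.

End symmetric_average.

Section scales.
Variables (s : nat -> seq G) (E : seq G) (K N : nat -> R).
Hypothesis s_gt0 : forall k, (0 < size (s k))%N.
Hypothesis s_sym : forall k, perm_eq (s k) [seq - x | x <- s k].
Hypothesis K_gt0 : forall k, 0 < K k.
Hypothesis poincare : forall k f, {in s k &, forall x y,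
  dot (T x f - T y f) (T x f - T y f) <= K k * gradient_form E f}.

(** Averages are composed so that the gradients lost at successive scales telescope. As they
    commute, the last one may be applied to [f] first, and [N_avg] still controls the result. *)
Fixpoint smoothing k f :=
  if k is j.+1 then average (s j) (smoothing j f) else f.

Lemma smoothing_average k s' f :
  smoothing k (average s' f) = average s' (smoothing k f).
Proof. by elim: k => //= k ->; rewrite averageC. Qed.

Lemma smoothing_norm_le k f : dot (smoothing k f) (smoothing k f) <= dot f f.
Proof. by elim: k => //= k; apply: le_trans; exact: average_norm_le. Qed.

Variable f : V.
Hypothesis N0 : dot f f <= N 0.
Hypothesis N_avg : forall k,
  dot (average (s k) f) (average (s k) f) <= N k.+1.

Lemma smoothing_le k : dot (smoothing k f) (smoothing k f) <= N k.
Proof.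
case: k => [|k] /=; first exact: N0.
by rewrite -smoothing_average (le_trans (smoothing_norm_le _ _)).
Qed.

Lemma multiscale_bound n u (t t' : R) : 0 < t -> 0 < t' ->
  2 * dot f u <= t * (\sum_(k < n) K k * N k) + (2 * t)^-1 * gradient_form E u
                 + t' * N n + t'^-1 * dot u u.
Proof.
move=> t0 t'0.
(* By symmetry of the k-th average P, <f_k, u_k> - <P f_k, P u_k> = <f_k, u_k - P^2 u_k>. *)
have tele : dot f u = \sum_(k < n)
    dot (smoothing k f) (smoothing k u - average (s k) (average (s k) (smoothing k u)))
    + dot (smoothing n f) (smoothing n u).
  elim: n => [|n IH]; first by rewrite big_ord0 add0r.
  rewrite big_ord_recr/= {}IH -addrA; congr (_ + _).
  by rewrite (dotDr dotP) (dotNr dotP) -average_sym// subrK.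
have step k : 2 * dot (smoothing k f)
    (smoothing k u - average (s k) (average (s k) (smoothing k u))) <=
    t * (K k * N k) + (2 * t)^-1 *
      (gradient_form E (smoothing k u) - gradient_form E (smoothing k.+1 u)).
  (* With the weight [t * K k] the Poincare constant of the scale cancels, leaving (2t)^-1 times the
     gradient lost. *)
  apply: (le_trans (dot_young dotP _ _ (mulr_gt0 t0 (K_gt0 k)))); apply: lerD.
    by rewrite -mulrA ler_pM2l// ler_pM2l// smoothing_le.
  have h := poincare_average2 (s_gt0 k) (s_sym k) (@poincare k) (smoothing k u).
  have tK : 0 <= (t * K k)^-1 by rewrite invr_ge0 mulr_ge0// ltW.
  apply: (le_trans (ler_wpM2l tK h)).
  rewrite le_eqVlt; apply/orP; left; apply/eqP => /=.
  by field; rewrite !gt_eqF.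
have tail : 2 * dot (smoothing n f) (smoothing n u) <=
    t' * N n + t'^-1 * dot u u.
  apply: (le_trans (dot_young dotP _ _ t'0)); apply: lerD.
    by rewrite ler_pM2l// smoothing_le.
  by rewrite ler_pM2l ?invr_gt0// smoothing_norm_le.
rewrite tele mulrDr -addrA; apply: lerD => //.
rewrite mulr_sumr; apply: (le_trans (ler_sum _ (fun (k : 'I_n) _ => step k))).
rewrite big_split/= -!mulr_sumr lerD2l ler_pM2l ?invr_gt0 ?mulr_gt0//.
rewrite (_ : \sum_(i < n) _ = gradient_form E u - gradient_form E (smoothing n u)).
  by rewrite gerBl; apply: sumr_ge0 => e _; exact: sdot_ge0.
elim: (n) => [|m IH]; first by rewrite big_ord0/= subrr.
by rewrite big_ord_recr/= IH addrA subrK.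
Qed.

End scales.
End multiscale.

(** * The lattice *)

Section lattice.
Variable d : nat.
Implicit Types x y e : Zd d.

Definition steps : seq (Zd d) := fset_set [set e : Zd d | neighbour 0 e].

Lemma mem_steps e : (e \in steps) = neighbour 0 e.
Proof.
rewrite in_fset_set; last exact: finite_neighbours.
by apply/idP/idP; rewrite inE.
Qed.

Lemma uniq_steps : uniq steps. Proof. exact: fset_uniq. Qed.

Lemma neighbour_opp e : neighbour 0 (- e) = neighbour 0 e.
Proof.
rewrite /neighbour; congr (_ == _); apply: eq_bigr => i _.
by rewrite !mxE opprK !add0r sqrrN.
Qed.

Lemma steps_sym : perm_eq steps [seq - e | e <- steps].
Proof.
apply: uniq_perm => [||e]; first exact: uniq_steps.
  by rewrite map_inj_uniq ?uniq_steps//; exact: oppr_inj.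
rewrite -[e in RHS]opprK mem_map; last exact: oppr_inj.
by rewrite !mem_steps neighbour_opp.
Qed.

Lemma box_sym n : perm_eq (box d n) [seq - x | x <- box d n].
Proof.
apply: uniq_perm => [||e]; first exact: fset_uniq.
  by rewrite map_inj_uniq ?fset_uniq//; exact: oppr_inj.
rewrite -[e in RHS]opprK mem_map; last exact: oppr_inj.
rewrite !in_box; apply: eq_forallb => i.
by rewrite mxE lerN2 lerNl andbC.
Qed.

Lemma size_box_ge n : ((n.*2.+1) ^ d <= #|` box d n|)%N.
Proof.
pose g (k : {ffun 'I_d -> 'I_n.*2.+1}) : Zd d := \row_i ((k i)%:Z - n%:Z).
have gI : injective g.
  move=> k l /rowP kl; apply/ffunP => i; apply: val_inj.
  by have := kl i; rewrite !mxE => /addIr [].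
have -> : (n.*2.+1 ^ d)%N = size [seq g k | k <- enum {ffun 'I_d -> 'I_n.*2.+1}].
  by rewrite size_map -cardE card_ffun !card_ord.
apply: uniq_leq_size; first by rewrite map_inj_uniq// enum_uniq.
move=> _ /mapP[k _ ->]; rewrite in_box; apply/forallP => i.
rewrite mxE; have : (k i < n.*2.+1)%N by [].
by move: (nat_of_ord _) => m; lia.
Qed.

Definition l1norm x : nat := \sum_(i < d) absz (x 0%R i).

Lemma l1norm_eq0 x : l1norm x = 0%N -> x = 0.
Proof.
move=> /eqP; rewrite sum_nat_eq0 => /forallP h.
by apply/rowP => i; have := h i; rewrite /= absz_eq0 mxE => /eqP.
Qed.

Lemma l1norm_step x m : l1norm x = m.+1 ->
  exists e y, [/\ neighbour 0 e, x = e + y & l1norm y = m].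
Proof.
move=> xm.
have [i xi] : exists i, x 0 i != 0.
  apply/existsP; apply: contra_eqT xm => /existsPn x0.
  rewrite /l1norm big1// => i _.
  by apply/eqP; rewrite absz_eq0; have := x0 i; rewrite negbK.
pose e : Zd d := Num.sg (x 0 i) *: delta_mx 0 i.
have ei j : e 0 j = if j == i then Num.sg (x 0 i) else 0.
  by rewrite !mxE eqxx/=; case: eqP; rewrite ?(mulr1, mulr0).
clearbody e.
exists e, (x - e); split; last 2 first.
- by rewrite addrC subrK.
- apply/eqP; rewrite -eqSS -xm /l1norm (bigD1 i)//= [X in _ == X](bigD1 i)//=.
  rewrite !mxE ei eqxx -addSn; apply/eqP; congr (_ + _)%N.
    by move: (x 0 i) xi => z; case: (ltrgt0P z) => // h _;
      rewrite ?(gtr0_sg h) ?(ltr0_sg h); lia.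
  apply: eq_bigr => j ji; congr absz.
  by rewrite !mxE ei (negbTE ji) subr0.
- apply/eqP; rewrite (bigD1 i)//= big1 => [|j ji].
    by rewrite mxE ei eqxx add0r sqrrN addr0 sqr_sg xi.
  by rewrite mxE ei (negbTE ji) subrr expr0n.
Qed.

Lemma l1norm_box n x y : x \in box d n -> y \in box d n ->
  (l1norm (x - y) <= d * n.*2)%N.
Proof.
rewrite !in_box => /forallP xn /forallP yn.
rewrite /l1norm -[X in (_ <= X * _)%N]card_ord -sum_nat_const.
apply: leq_sum => i _; rewrite !mxE.
have hx : - n%:Z <= x 0 i <= n%:Z := xn i.
have hy : - n%:Z <= y 0 i <= n%:Z := yn i.
by move: (x 0 i) (y 0 i) hx hy => a b; lia.
Qed.

Section lattice_action.
Variables (R : realFieldType) (V : lmodType R) (dot : V -> V -> R).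
Hypothesis dotP : semi_inner_product dot.
Variables (T : Zd d -> V -> V).
Hypothesis TD : forall x f g, T x (f + g) = T x f + T x g.
Hypothesis TZ : forall x c f, T x (c *: f) = c *: T x f.
Hypothesis TT : forall x y f, T x (T y f) = T (x + y) f.
Hypothesis T0 : forall f, T 0 f = f.
Hypothesis Tiso : forall x f g, dot (T x f) (T x g) = dot f g.

Let TN x f : T x (- f) = - T x f.
Proof. by rewrite -scaleN1r TZ scaleN1r. Qed.

Lemma gradient_form_ge0 E f : 0 <= gradient_form dot T E f.
Proof. by apply: sumr_ge0 => e _; exact: sdot_ge0. Qed.

(** Triangle inequality along a path of unit steps, in squared form: Young with weight 1/m combines
    m^2 g and g into (1 + 1/m) m^2 g + (1 + m) g = (m + 1)^2 g. The case m = 0 is apart because of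
    that weight. *)
Lemma poincare_point x f : dot (T x f - f) (T x f - f) <=
  (l1norm x)%:R ^+ 2 * gradient_form dot T steps f.
Proof.
move mE : (l1norm x) => m; elim: m => [|m IH] in x mE *.
  rewrite (l1norm_eq0 mE).
  by rewrite T0 subrr (dot0l dotP) expr0n mul0r.
have [e [y [e1 -> ym]]] := l1norm_step mE.
have ge : dot (T e f - f) (T e f - f) <= gradient_form dot T steps f.
  rewrite /gradient_form (bigD1_seq e) ?mem_steps ?uniq_steps//= lerDl.
  by apply: sumr_ge0 => z _; exact: sdot_ge0.
have [m0|m_gt0] := posnP m.
  by rewrite m0 in ym *; rewrite (l1norm_eq0 ym) addr0 expr1n mul1r.
have -> : T (e + y) f - f = T e (T y f - f) + (T e f - f).
  by rewrite TD TN TT addrA subrK.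
have := IH y ym; rewrite -(Tiso e).
set g := gradient_form _ _ _ _ in ge *; set a := T e _; set b := _ - _ in ge *.
clearbody a b; move=> ya.
have g0 : 0 <= g by exact: le_trans (sdot_ge0 dotP _) ge.
rewrite (dotDl dotP) !(dotDr dotP) (sdotC dotP b a).
have m0 : 0 < m%:R :> R by rewrite ltr0n.
have := dot_young dotP a b (t := m%:R^-1).
rewrite invr_gt0 invrK => /(_ m0) h.
have h2 : m%:R^-1 * dot a a <= m%:R * g.
  by rewrite -(ler_pM2l m0) mulVKf ?gt_eqF// mulrA -expr2.
have h3 : m%:R * dot b b <= m%:R * g by rewrite ler_pM2l.
rewrite -[m.+1]addn1 natrD.
nra.
Qed.

Lemma poincare_box n f : {in box d n &, forall x y,
  dot (T x f - T y f) (T x f - T y f) <=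
    (d * n.*2)%:R ^+ 2 * gradient_form dot T steps f}.
Proof.
move=> x y xn yn.
have -> : T x f - T y f = T y (T (x - y) f - f).
  by rewrite TD TN TT [y + _]addrC subrK.
rewrite Tiso; apply: (le_trans (poincare_point _ _)).
rewrite ler_wpM2r ?gradient_form_ge0//.
by rewrite lerXn2r ?nnegrE ?ler0n// ler_nat l1norm_box.
Qed.

End lattice_action.
End lattice.

(** * Environments *)

Section environment_maps.
Variables (d : nat) (R : realType).
Implicit Types (omega : Omega d R) (x y z e : Zd d).

Lemma env_eq omega omega' : weight omega =1 weight omega' -> omega = omega'.
Proof.
case: omega omega' => [w w0] [w' w0'] /= /funext ww'.
by case: _ / ww' in w0' *; congr Env; exact: Prop_irrelevance.
Qed.

Lemma theta0 omega : theta 0 omega = omega.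
Proof.
apply: env_eq => -[A A1] /=; congr (weight omega _); apply: eq_exist => /=.
by under eq_imagel do rewrite add0r; rewrite image_id.
Qed.

Lemma theta_comp x y omega : theta x (theta y omega) = theta (y + x) omega.
Proof.
apply: env_eq => a /=; congr (weight omega _); apply: eq_exist => /=.
by rewrite image_comp; apply: eq_imagel => z _ /=; rewrite addrA.
Qed.

Lemma measurable_weight (e : edge d) :
  measurable_fun [set: Omega d R] (fun omega => weight omega e).
Proof.
move=> _ A mA; rewrite setTI; apply: sub_sigma_algebra.
by exists e, A.
Qed.

Lemma measurable_conductance x y :
  measurable_fun [set: Omega d R] (fun omega => conductance omega x y).
Proof.
rewrite /conductance; case: pselect => xy; first exact: measurable_weight.
exact: measurable_cst.
Qed.

Lemma measurable_theta x : measurable_fun [set: Omega d R] (@theta d R x).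
Proof.
apply: (@measurability _ _ (Omega d R) (Omega d R) setT (theta x) (@cylinders d R)) => //.
move=> _ [_ [e [A [mA ->]]] <-].
exact: measurable_weight (shift_edge x e) measurableT _ mA.
Qed.

Lemma exit_rateE omega x :
  exit_rate omega x = \sum_(e <- steps d) conductance omega x (x + e).
Proof.
rewrite /exit_rate fsbig_finite/=; last exact: finite_neighbours.
rewrite -[RHS](big_map (+%R x) predT (conductance omega x)).
apply: perm_big; apply: uniq_perm; first exact: fset_uniq.
  by rewrite map_inj_uniq ?uniq_steps//; exact: addrI.
move=> y; rewrite in_fset_set; last exact: finite_neighbours.
rewrite -[y in RHS](addrNK x) addrC mem_map; last exact: addrI.
rewrite mem_steps -[in RHS](neighbourDl x) addr0 addrC subrK.
by apply/idP/idP; rewrite inE.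
Qed.

Lemma measurable_exit_rate x :
  measurable_fun [set: Omega d R] (fun omega => exit_rate omega x).
Proof.
under eq_fun do rewrite exit_rateE.
by apply: measurable_sum => e; exact: measurable_conductance.
Qed.

Lemma exit_rate_theta omega x y :
  exit_rate (theta x omega) y = exit_rate omega (x + y).
Proof.
rewrite !exit_rateE; apply: eq_bigr => e _.
by rewrite conductance_theta addrA.
Qed.

Lemma conductance_ge0 omega x y : 0 <= conductance omega x y.
Proof. by rewrite /conductance; case: pselect => // xy; exact/ltW/weight_gt0. Qed.

Lemma conductance_gt0 omega x y : neighbour x y -> 0 < conductance omega x y.
Proof. by rewrite /conductance; case: pselect => // xy _; exact: weight_gt0. Qed.

Lemma conductance_eq0 omega x y : ~~ neighbour x y -> conductance omega x y = 0.
Proof. by rewrite /conductance; case: pselect => // xy; rewrite xy. Qed.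

Lemma conductance_le_exit_rate omega x e :
  e \in steps d -> conductance omega x (x + e) <= exit_rate omega x.
Proof.
move=> es; rewrite exit_rateE (bigD1_seq e) ?uniq_steps//= lerDl.
by apply: sumr_ge0 => z _; exact: conductance_ge0.
Qed.

Lemma exit_rate_gt0 omega x : (0 < d)%N -> 0 < exit_rate omega x.
Proof.
move=> d0; have e1 : neighbour 0 (delta_mx 0 (Ordinal d0) : Zd d).
  apply/eqP; rewrite (bigD1 (Ordinal d0))//= big1 => [|j ji].
    by rewrite !mxE !eqxx addr0 add0r sqrrN expr1n.
  by rewrite !mxE eqxx (negbTE ji) subrr expr0n.
apply: (lt_le_trans _ (conductance_le_exit_rate omega x _)); last first.
  by rewrite mem_steps; exact: e1.
by apply: conductance_gt0; rewrite -[x in neighbour x](addr0 x) neighbourDl.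
Qed.

End environment_maps.

(** * Square-integrable functions and stationarity *)

Section square_integrable.
Local Open Scope ereal_scope.
Context dT (T : measurableType dT) (R : realType) (P : probability T R).

Lemma mem_Lfun2 (f : T -> R) : measurable_fun setT f ->
  \int[P]_x ((f x) ^+ 2)%:E < +oo -> f \in Lfun P 2%:E.
Proof.
move=> mf f2; rewrite inE; apply/andP; split; rewrite inE//=.
rewrite /finite_norm unlock/=; apply: poweR_lty.
by under eq_integral do rewrite /= powR_mulrn// real_normK ?num_real//.
Qed.

Lemma Lfun2_measurable (f : T -> R) : f \in Lfun P 2%:E -> measurable_fun setT f.
Proof. by rewrite inE => /andP[]; rewrite inE. Qed.

Lemma Lfun2_sqr_lty (f : T -> R) : f \in Lfun P 2%:E ->
  \int[P]_x ((f x) ^+ 2)%:E < +oo.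
Proof.
move=> /Lfun2_integrable_sqr/integrableP[_]; apply: le_lt_trans.
rewrite le_eqVlt; apply/orP; left; apply/eqP; apply: eq_integral => x _ /=.
by rewrite ger0_norm// sqr_ge0.
Qed.

Lemma Lfun2_dominated (f g : T -> R) (C : R) : measurable_fun setT f ->
  g \in Lfun P 2%:E -> (forall x, `|f x| <= C * `|g x|)%R -> f \in Lfun P 2%:E.
Proof.
move=> mf lg fg; apply: mem_Lfun2 => //.
apply: (@le_lt_trans _ _ (\int[P]_x ((C ^+ 2)%:E * ((g x) ^+ 2)%:E))).
  apply: ge0_le_integral => //.
  - by move=> x _; rewrite lee_fin sqr_ge0.
  - by apply/measurable_EFinP; exact: measurable_funX.
  - under eq_fun do rewrite -EFinM.
    apply/measurable_EFinP; apply: measurable_funM => //.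
    by apply: measurable_funX; exact: Lfun2_measurable lg.
  - move=> x _; rewrite -EFinM lee_fin -exprMn -[leLHS]real_normK ?num_real//.
    rewrite -[leRHS]real_normK ?num_real// lerXn2r ?nnegrE//.
    rewrite (le_trans (fg x))// normrM ler_wpM2r// ler_norm//.
rewrite ge0_integralZl//.
- by rewrite lte_mul_pinfty ?lee_fin ?sqr_ge0//; exact: Lfun2_sqr_lty.
- by apply/measurable_EFinP/measurable_funX; exact: Lfun2_measurable lg.
- by move=> x _; rewrite lee_fin sqr_ge0.
- by rewrite lee_fin sqr_ge0.
Qed.

Let p12 : 1 <= 2%:E :> \bar R. Proof. by rewrite lee_fin ler1n. Qed.

Definition L2 := LfunType P p12.

Definition toL2 (f : T -> R) (fP : f \in Lfun P 2%:E) : L2 := Lfun_Sub p12 fP.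

Lemma L2P (f : L2) : (f : T -> R) \in Lfun P 2%:E.
Proof. exact: LfunP. Qed.

Lemma L2_measurable (f : L2) : measurable_fun setT f.
Proof. exact/Lfun2_measurable/L2P. Qed.

Lemma L2DE (f g : L2) x : ((f + g)%R : L2) x = (f x + g x)%R.
Proof. by []. Qed.

Lemma L2ZE a (f : L2) x : ((a *: f)%R : L2) x = (a * f x)%R.
Proof. by []. Qed.

Lemma L2NE (f : L2) x : ((- f)%R : L2) x = (- f x)%R.
Proof. by []. Qed.

Lemma L2_sumE I (s : seq I) (F : I -> L2) x :
  ((\sum_(i <- s) F i)%R : L2) x = (\sum_(i <- s) F i x)%R.
Proof.
elim: s => [|i s IH]; first by rewrite !big_nil.
by rewrite !big_cons L2DE IH.
Qed.

Definition ip (f g : L2) : R := fine (\int[P]_x (f x * g x)%:E).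

Lemma L2_mul_integrable (f g : L2) :
  P.-integrable setT (fun x => (f x * g x)%:E).
Proof. by have /Lfun1_integrable := Lfun2_mul_Lfun1 (L2P f) (L2P g). Qed.

Lemma ipE (f g : L2) : (ip f g)%:E = \int[P]_x (f x * g x)%:E.
Proof. by rewrite fineK// integrable_fin_num//; exact: L2_mul_integrable. Qed.

Lemma ip_sqrE (f : L2) : (ip f f)%:E = \int[P]_x (f x ^+ 2)%:E.
Proof. by rewrite ipE; apply: eq_integral => x _; rewrite expr2. Qed.

Lemma ip_semi_inner_product : semi_inner_product ip.
Proof.
split.
- by move=> f g; congr fine; apply: eq_integral => x _; rewrite mulrC.
- move=> f g h; apply: EFin_inj; rewrite [RHS]EFinD !ipE -integralD//;
    try exact: L2_mul_integrable.
  by apply: eq_integral => x _; rewrite L2DE mulrDl EFinD.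
- move=> a f h; apply: EFin_inj; rewrite [RHS]EFinM !ipE -integralZl//;
    last exact: L2_mul_integrable.
  by apply: eq_integral => x _; rewrite L2ZE -mulrA EFinM.
- move=> f; rewrite fine_ge0// integral_ge0// => x _.
  by rewrite lee_fin -expr2 sqr_ge0.
Qed.

End square_integrable.

Section stationary.
Variables (d : nat) (R : realType) (P : probability (Omega d R) R).
Hypothesis P_invariant : forall (x : Zd d) (A : set (Omega d R)),
  measurable A -> P (theta x @^-1` A) = P A.
Implicit Types (omega : Omega d R) (x y e : Zd d).

Lemma ge0_integral_theta x (f : Omega d R -> \bar R) :
  measurable_fun setT f -> (forall omega, 0 <= f omega)%E ->
  (\int[P]_omega f (theta x omega) = \int[P]_omega f omega)%E.
Proof.
move=> mf f0; have := ge0_integral_pushforward (measurable_theta x) P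
  measurableT mf (fun o _ => f0 o).
rewrite preimage_setT => <-; apply: eq_measure_integral; first exact: measurable_theta.
by move=> mtheta A mA _; exact: P_invariant.
Qed.

Lemma integral_theta x (f : Omega d R -> \bar R) :
  P.-integrable setT f ->
  (\int[P]_omega f (theta x omega) = \int[P]_omega f omega)%E.
Proof.
move=> /integrableP[mf _]; rewrite [LHS]integralE [RHS]integralE.
congr (_ - _)%E; rewrite -[RHS](ge0_integral_theta x)//.
- by rewrite -[fun o => f _]/(f \o theta x) funepos_comp.
- exact: measurable_funepos.
- by rewrite -[fun o => f _]/(f \o theta x) funeneg_comp.
- exact: measurable_funeneg.
Qed.

Lemma Lfun2_theta x (f : Omega d R -> R) : f \in Lfun P 2%:E ->
  f \o theta x \in Lfun P 2%:E.
Proof.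
move=> fL; have mf := Lfun2_measurable fL; apply: mem_Lfun2.
  exact: measurableT_comp (measurable_theta x).
rewrite (ge0_integral_theta x (f := fun o => ((f o) ^+ 2)%:E)).
- exact: Lfun2_sqr_lty.
- by apply/measurable_EFinP; exact: measurable_funX.
- by move=> o; rewrite lee_fin sqr_ge0.
Qed.

Definition translate x (f : L2 P) : L2 P := toL2 (Lfun2_theta x (L2P f)).

Lemma translateD x f g : translate x (f + g) = translate x f + translate x g.
Proof. exact/LfuneqP. Qed.

Lemma translateZ x c f : translate x (c *: f) = c *: translate x f.
Proof. exact/LfuneqP. Qed.

Lemma translate_comp x y f :
  translate x (translate y f) = translate (x + y) f.
Proof. by apply/LfuneqP => omega; rewrite /= theta_comp. Qed.

Lemma translate0 f : translate 0 f = f.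
Proof. by apply/LfuneqP => omega; rewrite /= theta0. Qed.

Lemma translate_iso x f g : ip (translate x f) (translate x g) = ip f g.
Proof.
congr fine; apply: (integral_theta x (f := fun o => (f o * g o)%:E)).
exact: L2_mul_integrable.
Qed.

Lemma Nnorm_ge0 (f : Omega d R -> R) : (0 <= Nnorm P f)%E.
Proof.
apply: (@ereal_sup_ge _ _ _); exists
   ((#|` box d 0|%:R^-1)%:E * \int[P]_omega ((box_sum 0 f omega) ^+ 2)%:E)%E.
  by exists 0%N.
apply: mule_ge0; first by rewrite lee_fin invr_ge0.
by apply: integral_ge0 => omega _; rewrite lee_fin sqr_ge0.
Qed.

Lemma box0 : box d 0 = [fset (0 : Zd d)]%fset.
Proof.
apply/fsetP => x; rewrite in_box inE; apply/forallP/eqP => [h|-> i].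
  apply/rowP => i; have h1 : - 0%:Z <= x 0 i <= 0%:Z := h i.
  by apply/eqP; rewrite mxE eq_le -oppr0 andbC oppr0.
by rewrite mxE.
Qed.

Lemma Nnorm_Lfun2 f : measurable_fun setT f -> (Nnorm P f < +oo)%E ->
  f \in Lfun P 2%:E.
Proof.
move=> mf Nf; apply: mem_Lfun2 => //; apply: le_lt_trans Nf.
apply: ereal_sup_ubound; exists 0%N => //.
rewrite box0 cardfs1 invr1 mul1e; apply: eq_integral => o _.
by rewrite /box_sum box0 big_seq_fset1 theta0.
Qed.

Section multiscale_N.
Hypothesis d_gt0 : (0 < d)%N.
Variable f : L2 P.
Hypothesis Nf : (Nnorm P f < +oo)%E.
Let N : R := fine (Nnorm P f).

Let NE : N%:E = Nnorm P f.
Proof. by rewrite fineK// ge0_fin_numE// Nnorm_ge0. Qed.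

Lemma box_card_gt0 n : (0 < #|` box d n|)%N.
Proof. by apply: leq_trans (size_box_ge d n); rewrite expn_gt0. Qed.

(** The average divides the square of the box sum by |B_n|^2, N(f) by |B_n| only; the spare factor
    is the gain. *)
Lemma average_box_norm n :
  ip (average translate (box d n) f) (average translate (box d n) f)
    <= N / #|` box d n|%:R.
Proof.
have b0 : 0 < #|` box d n|%:R :> R by rewrite ltr0n box_card_gt0.
set b := #|` box d n|%:R in b0 *.
rewrite ler_pdivlMr// -lee_fin NE EFinM ip_sqrE.
apply: ereal_sup_ubound; exists n => //; rewrite -/b.
rewrite (_ : (b^-1)%:E = b%:E * (b^-2)%:E)%E; last first.
  by rewrite -EFinM; congr EFin; field; rewrite gt_eqF.
rewrite -muleA [RHS]muleC; congr (_ * _)%E.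
rewrite -ge0_integralZl//; last 2 first.
- by move=> o _; rewrite lee_fin sqr_ge0.
- by rewrite lee_fin invr_ge0 exprn_ge0// ltW.
  apply: eq_integral => o _; rewrite -EFinM /average L2ZE L2_sumE exprMn exprVn.
  by [].
apply/measurable_EFinP/measurable_funX; rewrite /box_sum.
apply: measurable_sum => x; apply: measurableT_comp (measurable_theta x).
exact: L2_measurable.
Qed.

(** Up to constants, 4^k is the squared diameter of the k-th box and 2^(kd) its volume. The growth
    of this sum separates the three cases of dimension. *)
Definition scale_sum n : R := \sum_(k < n) 4 ^+ k / 2 ^+ (k * d).

Lemma multiscale_N n u (t t' : R) : 0 < t -> 0 < t' ->
  2 * ip f u <= t * (16 * d%:R ^+ 2 * scale_sum n * N)
    + (2 * t)^-1 * gradient_form (@ip _ _ _ P) translate (steps d) u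
    + t' * (N / 2 ^+ (n * d)) + t'^-1 * ip u u.
Proof.
move=> t0 t'0; have N0 : 0 <= N by rewrite fine_ge0// Nnorm_ge0.
have dotP := @ip_semi_inner_product _ _ _ P.
(* With radius 2^(k+1) - 1 the box has at least 2^((k+1)d) points, whence [NN k.+1], and l1-diameter
   at most d 2^(k+2), whose square is [K k]. *)
pose s k : seq (Zd d) := box d (2 ^ k.+1).-1.
pose K k : R := 16 * d%:R ^+ 2 * 4 ^+ k.
pose NN k : R := N / 2 ^+ (k * d).
have := @multiscale_bound _ _ _ dotP _ translate translateD translateZ
  translate_comp translate0 translate_iso s (steps d) K NN _ _ _ _ f _ _ n u t t' t0 t'0.
rewrite (_ : \sum_(_ < n) _ = 16 * d%:R ^+ 2 * scale_sum n * N); last first.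
  rewrite /scale_sum mulr_sumr mulr_suml; apply: eq_bigr => k _.
  by rewrite /K /NN; ring.
apply.
- by move=> k; exact: box_card_gt0.
- by move=> k; exact: box_sym.
- by move=> k; rewrite !mulr_gt0 ?exprn_gt0 ?ltr0n.
- move=> k g x y xs ys.
  have := poincare_box dotP translateD translateZ translate_comp translate0
    translate_iso g xs ys.
  move=> /le_trans; apply; apply: ler_wpM2r.
    exact: gradient_form_ge0.
  have -> : K k = (d * 2 ^ k.+2)%:R ^+ 2.
    rewrite /K natrM natrX !exprS (_ : 4 = 2 * 2 :> R) ?exprMn; last by ring.
    by ring.
  rewrite lerXn2r ?nnegrE ?ler0n// ler_nat leq_mul2l (expnS 2 k.+1) mul2n leq_double leq_pred.
  by rewrite orbT.
(* Before any averaging, the bound is that of the box of radius 0, whose average is the identity. *)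
- rewrite /NN mul0n expr0 divr1.
  have := average_box_norm 0; rewrite box0 cardfs1 divr1; apply: le_trans.
  rewrite le_eqVlt; apply/orP; left; apply/eqP.
  have -> // : average translate [fset (0 : Zd d)]%fset f = f.
  rewrite /average -[size _]/(#|` [fset (0 : Zd d)]%fset|) cardfs1 big_seq_fset1.
  by rewrite translate0 invr1 scale1r.
- move=> k; apply: (le_trans (average_box_norm _)); rewrite /NN.
  rewrite ler_wpM2l// lef_pV2 ?posrE ?exprn_gt0 ?ltr0n ?box_card_gt0//.
  rewrite -natrX ler_nat; apply: leq_trans (size_box_ge d _).
  rewrite expnM leq_exp2r//.
  have : (0 < 2 ^ k.+1)%N by rewrite expn_gt0.
  rewrite -addnn; lia.
Qed.

End multiscale_N.
End stationary.

(** * The symmetrised environment chain *)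

Lemma measurable_funV dT (T : measurableType dT) (R : realType) (f : T -> R) :
  measurable_fun setT f -> (forall x, 0 < f x) ->
  measurable_fun setT (fun x => (f x)^-1).
Proof.
move=> mf f0; rewrite (_ : (fun x => (f x)^-1) = (@powR R)^~ (-1) \o f).
  by apply: measurableT_comp => //; exact: measurable_powR.
by apply/funext => x /=; rewrite powR_inv1// ltW.
Qed.

Section multiplication.
Context dT (T : measurableType dT) (R : realType) (P : probability T R).

Definition mulL2 (m : T -> R) (mm : measurable_fun setT m)
    (m1 : forall x, `|m x| <= 1) (f : L2 P) : L2 P :=
  toL2 (Lfun2_dominated (measurable_funM mm (L2_measurable f)) (L2P f)
    (fun x => eq_ind_r (fun y => y <= 1 * `|f x|)
      (ler_wpM2r (normr_ge0 (f x)) (m1 x)) (normrM (m x) (f x)))).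

Section mulL2_theory.
Variables (m : T -> R) (mm : measurable_fun setT m) (m1 : forall x, `|m x| <= 1).
Notation mul := (mulL2 mm m1).

Lemma mulL2E f x : mul f x = m x * f x. Proof. by []. Qed.

Lemma mulL2D f g : mul (f + g) = mul f + mul g.
Proof. by apply/LfuneqP => x; rewrite L2DE !mulL2E L2DE mulrDr. Qed.

Lemma mulL2Z c f : mul (c *: f) = c *: mul f.
Proof. by apply/LfuneqP => x; rewrite L2ZE !mulL2E L2ZE mulrCA. Qed.

Lemma mulL2_sym f g : ip (mul f) g = ip f (mul g).
Proof.
by congr fine; apply: eq_integral => x _; rewrite !mulL2E mulrAC mulrC mulrA.
Qed.

End mulL2_theory.

Lemma le_ip (f1 g1 f2 g2 : L2 P) :
  (forall x, 0 <= f1 x * g1 x) -> (forall x, 0 <= f2 x * g2 x) ->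
  {ae P, forall x, f1 x * g1 x <= f2 x * g2 x} -> ip f1 g1 <= ip f2 g2.
Proof.
move=> p1 p2 le12; rewrite -lee_fin !ipE; apply: ae_ge0_le_integral => //.
- by move=> x _; rewrite lee_fin.
- by apply/measurable_EFinP/measurable_funM; exact: L2_measurable.
- by move=> x _; rewrite lee_fin.
- by apply/measurable_EFinP/measurable_funM; exact: L2_measurable.
- by apply: filterS le12 => x h _; rewrite lee_fin.
Qed.

Lemma ip_mul_le m mm m1 (f : L2 P) :
  ip (mulL2 (m := m) mm m1 f) (mulL2 mm m1 f) <= ip f f.
Proof.
apply: le_ip => [x|x|]; rewrite -?expr2 ?sqr_ge0//.
apply/aeW => x; rewrite !mulL2E -!expr2 exprMn ler_piMl ?sqr_ge0//.
by rewrite -[leLHS]real_normK ?num_real// expr_le1.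
Qed.

End multiplication.

Section discretisation.
Variables (d : nat) (R : realType) (P : probability (Omega d R) R).
Hypothesis d_gt0 : (0 < d)%N.
Hypothesis P_invariant : forall (x : Zd d) (A : set (Omega d R)),
  measurable A -> P (theta x @^-1` A) = P A.
Hypothesis P_ge1 : forall e : edge d,
  {ae P, forall omega : Omega d R, 1 <= weight omega e}.
Variable g : R.
Hypothesis g_gt0 : 0 < g.
Implicit Types (omega : Omega d R) (e : Zd d) (f : L2 P).

(** The probability of not leaving the origin during one grid step. *)
Definition stay omega := expR (- (exit_rate omega 0 / g)).

Definition phi2 omega := (1 - stay omega) / (exit_rate omega 0 / g).

Definition phi omega := Num.sqrt (phi2 omega).

Let rg_gt0 omega : 0 < exit_rate omega 0 / g.
Proof. by rewrite divr_gt0// exit_rate_gt0. Qed.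

Lemma stay_lt1 omega : stay omega < 1.
Proof. by rewrite expR_lt1 oppr_lt0. Qed.

Lemma phi2_rate omega : phi2 omega * (exit_rate omega 0 / g) = 1 - stay omega.
Proof. by rewrite divfK// gt_eqF. Qed.

Lemma phi2_gt0 omega : 0 < phi2 omega.
Proof. by rewrite divr_gt0// subr_gt0 stay_lt1. Qed.

Lemma phi2_le1 omega : phi2 omega <= 1.
Proof.
rewrite ler_pdivrMr// mul1r lerBlDl -lerBlDr.
by have := expR_ge1Dx (- (exit_rate omega 0 / g)).
Qed.

(** For r = pi/g this is r / (1 - e^(-r)) <= 1 + r, that is (1 + r) e^(-r) <= 1. Where pi <= M, the
    weight thus costs at most M/g. *)
Lemma invphi2_le omega : (phi2 omega)^-1 <= 1 + exit_rate omega 0 / g.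
Proof.
rewrite invf_div ler_pdivrMr ?subr_gt0 ?stay_lt1//.
have := expR_ge1Dx (exit_rate omega 0 / g).
set x := _ / g; rewrite -(ler_pM2r (expR_gt0 (- x))) -expRD subrr expR0.
by rewrite /stay -/x; lra.
Qed.

Lemma phi_gt0 omega : 0 < phi omega.
Proof. by rewrite sqrtr_gt0 phi2_gt0. Qed.

Lemma phi_sqr omega : phi omega ^+ 2 = phi2 omega.
Proof. by rewrite sqr_sqrtr// ltW// phi2_gt0. Qed.

Lemma phi_le1 omega : `|phi omega| <= 1.
Proof.
rewrite ger0_norm ?sqrtr_ge0// -(@expr_le1 _ 2) ?sqrtr_ge0//.
by rewrite phi_sqr phi2_le1.
Qed.

Lemma measurable_stay : measurable_fun setT stay.
Proof.
apply: measurableT_comp (@measurable_expR R) _; apply: measurable_funN.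
by apply: measurable_funM => //; exact: measurable_exit_rate.
Qed.

Lemma measurable_sqrt : measurable_fun [set: R] Num.sqrt.
Proof. by apply: continuous_measurable_fun; exact: sqrt_continuous. Qed.

Lemma measurable_phi : measurable_fun setT phi.
Proof.
apply: measurableT_comp measurable_sqrt _.
apply: measurable_funM; first by apply: measurable_funB => //; exact: measurable_stay.
by apply: measurable_funV => //; apply: measurable_funM => //; exact: measurable_exit_rate.
Qed.

(** [bond e * phi] is the square root of the probability of jumping along [e] in one grid step. The
    bond alone may be unbounded; only its products with [phi] or its translate are used as
    multipliers. *)
Definition bond e omega := Num.sqrt (conductance omega 0 e / g).

Lemma measurable_bond e : measurable_fun setT (bond e).
Proof.
apply: measurableT_comp measurable_sqrt _; apply: measurable_funM => //.
exact: measurable_conductance.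
Qed.

Lemma bond_sqr e omega : bond e omega ^+ 2 = conductance omega 0 e / g.
Proof. by rewrite sqr_sqrtr// divr_ge0 ?conductance_ge0// ltW. Qed.

Lemma sum_bond omega : \sum_(e <- steps d) bond e omega ^+ 2 = exit_rate omega 0 / g.
Proof.
under eq_bigr do rewrite bond_sqr.
by rewrite -mulr_suml exit_rateE; under [in RHS]eq_bigr do rewrite add0r.
Qed.

Lemma bond_phi_le1 e omega : `|bond e omega * phi omega| <= 1.
Proof.
have bp : 0 <= bond e omega * phi omega by rewrite mulr_ge0 ?sqrtr_ge0.
rewrite ger0_norm// -(@expr_le1 _ 2)// exprMn phi_sqr bond_sqr.
have : phi2 omega * (exit_rate omega 0 / g) <= 1.
  by rewrite phi2_rate gerBl ltW// expR_gt0.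
apply: le_trans; rewrite mulrC ler_wpM2l ?(ltW (phi2_gt0 _))//.
rewrite ler_pM2r ?invr_gt0//.
have [es|es] := boolP (e \in steps d).
  by have := conductance_le_exit_rate omega 0 es; rewrite add0r.
by rewrite conductance_eq0 -?mem_steps// ltW// exit_rate_gt0.
Qed.

Lemma bond_theta e omega : bond (- e) (theta e omega) = bond e omega.
Proof. by rewrite /bond conductance_theta addr0 subrr conductanceC. Qed.

Lemma measurable_bond_phi e : measurable_fun setT (fun o => bond e o * phi o).
Proof. exact: measurable_funM (measurable_bond e) measurable_phi. Qed.

Lemma measurable_bond_phi_theta e :
  measurable_fun setT (fun o => bond e o * phi (theta e o)).
Proof.
apply: measurable_funM (measurable_bond e) _.
exact: measurableT_comp measurable_phi (measurable_theta e).
Qed.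

Lemma bond_phi_theta_le1 e omega : `|bond e omega * phi (theta e omega)| <= 1.
Proof. by rewrite -bond_theta bond_phi_le1. Qed.

Lemma sqrt_stay_le1 omega : `|Num.sqrt (stay omega)| <= 1.
Proof.
rewrite ger0_norm ?sqrtr_ge0// -[leRHS]sqrtr1 ler_sqrt// ltW//.
exact: stay_lt1.
Qed.

Lemma measurable_sqrt_stay : measurable_fun setT (fun o => Num.sqrt (stay o)).
Proof. exact: measurableT_comp measurable_sqrt measurable_stay. Qed.

Notation tr := (translate P_invariant).

Definition Xop e := mulL2 (P := P) (measurable_bond_phi e) (bond_phi_le1 e).

(** Carries the square root of the probability of the reversed jump, from [theta e omega] back to
    [omega]. By [YopE] it is a translate of [Xop (- e)]; the symmetry of the conductances enters
    there. *)
Definition Yop e f :=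
  mulL2 (P := P) (measurable_bond_phi_theta e) (bond_phi_theta_le1 e) (tr e f).

Definition Zop := mulL2 (P := P) measurable_sqrt_stay sqrt_stay_le1.

Definition Phi := mulL2 (P := P) measurable_phi phi_le1.

Definition Bop f := Zop (Zop f) + \sum_(e <- steps d) Xop e (Yop e f).

Let ipP := @ip_semi_inner_product _ _ _ P.

Lemma YopE e f : Yop e f = tr e (Xop (- e) f).
Proof. by apply/LfuneqP => o; rewrite /= bond_theta. Qed.

Lemma XopN e f : Xop (- e) f = tr (- e) (Yop e f).
Proof. by rewrite YopE translate_comp addNr translate0. Qed.

Lemma ip_XY e f h : ip (Xop e f) (Yop e h) = ip (Yop (- e) f) (Xop (- e) h).
Proof. by rewrite (YopE (- e)) opprK XopN translate_iso. Qed.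

Lemma sum_YY f h :
  \sum_(e <- steps d) ip (Yop e f) (Yop e h) =
  \sum_(e <- steps d) ip (Xop e f) (Xop e h).
Proof.
rewrite [RHS](perm_big _ (steps_sym d))/= big_map.
by apply: eq_bigr => e _; rewrite !YopE translate_iso.
Qed.

(** The probabilities of staying and of jumping add up to 1. Since B has Y_e in place of the second
    X_e, and the Y_e have the same total square by [sum_YY], both 1 - B and 1 + B are sums of
    squares. *)
Lemma resolutionE f : f = Zop (Zop f) + \sum_(e <- steps d) Xop e (Xop e f).
Proof.
apply/LfuneqP => o; rewrite L2DE L2_sumE !mulL2E mulrA -expr2 sqr_sqrtr ?expR_ge0//.
under eq_bigr do rewrite !mulL2E mulrA -expr2 exprMn phi_sqr.
by rewrite -!mulr_suml sum_bond [_ * phi2 _]mulrC phi2_rate -mulrDl addrC subrK mul1r.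
Qed.

Lemma ip_resolution f h : ip f h = ip (Zop f) (Zop h) +
  \sum_(e <- steps d) ip (Xop e f) (Xop e h).
Proof.
rewrite [in LHS](resolutionE h) (dotDr ipP) (dot_sumr ipP) mulL2_sym.
by congr (_ + _); apply: eq_bigr => e _; rewrite mulL2_sym.
Qed.

Lemma ip_Bop f h : ip f (Bop h) = ip (Zop f) (Zop h) +
  \sum_(e <- steps d) ip (Xop e f) (Yop e h).
Proof.
rewrite (dotDr ipP) (dot_sumr ipP) mulL2_sym.
by congr (_ + _); apply: eq_bigr => e _; rewrite mulL2_sym.
Qed.

Lemma BopD f h : Bop (f + h) = Bop f + Bop h.
Proof.
rewrite /Bop /Zop /Xop !mulL2D addrACA -big_split; congr (_ + _).
by apply: eq_bigr => e _; rewrite /Yop translateD !mulL2D.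
Qed.

Lemma BopZ c f : Bop (c *: f) = c *: Bop f.
Proof.
rewrite /Bop /Zop /Xop !mulL2Z scalerDr scaler_sumr; congr (_ + _).
by apply: eq_bigr => e _; rewrite /Yop translateZ !mulL2Z.
Qed.

Lemma Bop_sym f h : ip (Bop f) h = ip f (Bop h).
Proof.
rewrite (sdotC ipP) !ip_Bop (sdotC ipP); congr (_ + _).
rewrite [RHS](perm_big _ (steps_sym d))/= big_map.
by apply: eq_bigr => e _; rewrite ip_XY (sdotC ipP).
Qed.

Lemma dirichletE f : 2 * (ip f f - ip f (Bop f)) =
  \sum_(e <- steps d) ip (Xop e f - Yop e f) (Xop e f - Yop e f).
Proof.
under [RHS]eq_bigr do rewrite (dot_sqrB ipP).
rewrite big_split sumrB -mulr_sumr /=.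
have := ip_Bop f f; have := ip_resolution f f; have := sum_YY f f.
by move=> -> -> ->; ring.
Qed.

Lemma dirichlet_addE f : 2 * (ip f f + ip f (Bop f)) =
  4 * ip (Zop f) (Zop f) +
  \sum_(e <- steps d) ip (Xop e f + Yop e f) (Xop e f + Yop e f).
Proof.
under [in RHS]eq_bigr do rewrite (dot_sqrD ipP).
rewrite !big_split -mulr_sumr /=.
have := ip_Bop f f; have := ip_resolution f f; have := sum_YY f f.
by move=> -> -> ->; ring.
Qed.

Lemma Bop_le f : 0 <= ip f f - ip f (Bop f).
Proof.
rewrite -(pmulr_rge0 _ (ltr0n R 2)) dirichletE sumr_ge0// => e _.
exact: sdot_ge0.
Qed.

Lemma Bop_ge f : 0 <= ip f f + ip f (Bop f).
Proof.
rewrite -(pmulr_rge0 _ (ltr0n R 2)) dirichlet_addE addr_ge0//.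
  by rewrite mulr_ge0// sdot_ge0.
by apply: sumr_ge0 => e _; exact: sdot_ge0.
Qed.

Lemma dirichlet_le f : ip f f - ip f (Bop f) <=
  2 * \sum_(e <- steps d) ip (Xop e f) (Xop e f).
Proof.
rewrite -(ler_pM2l (ltr0n R 2)) dirichletE.
apply: (@le_trans _ _ (\sum_(e <- steps d)
    (2 * ip (Xop e f) (Xop e f) + 2 * ip (Yop e f) (Yop e f)))).
  by apply: ler_sum => e _; exact: dot_subr_le.
by rewrite big_split/= -!mulr_sumr sum_YY; lra.
Qed.

(** The bond is the same seen from both ends, so X_e f - Y_e f is the bond times phi f - T_e (phi
    f), and the squared bond is omega_e / g >= 1 / g. *)
Lemma gradient_le_dirichlet f :
  gradient_form (@ip _ _ _ P) tr (steps d) (Phi f)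
    <= 2 * g * (ip f f - ip f (Bop f)).
Proof.
rewrite [2 * g]mulrC -mulrA dirichletE mulr_sumr /gradient_form.
rewrite big_seq [leRHS]big_seq; apply: ler_sum => e es.
have e1 : neighbour 0 e by rewrite -mem_steps.
rewrite -(dotZl ipP); apply: le_ip => [w|w|].
- by rewrite -expr2 sqr_ge0.
- by rewrite L2ZE -mulrA -expr2 mulr_ge0 ?sqr_ge0// ltW.
have : {ae P, forall omega, 1 <= weight omega (mk_edge e1)} by exact: P_ge1.
apply: filterS => o c1.
rewrite !L2DE !L2NE !L2ZE L2DE L2NE !mulL2E.
have -> : tr e (Phi f) o = phi (theta e o) * f (theta e o) by [].
have -> : tr e f o = f (theta e o) by [].
set a := phi o; set b := phi (theta e o); set u := f o; set v := f (theta e o).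
have -> : g * (bond e o * a * u - bond e o * b * v) *
    (bond e o * a * u - bond e o * b * v) =
    (g * bond e o ^+ 2) * ((b * v - a * u) * (b * v - a * u)) by ring.
rewrite ler_peMl -?expr2 ?sqr_ge0// bond_sqr mulrCA divff ?gt_eqF// mulr1.
by rewrite /conductance; case: pselect => // xy; rewrite (Prop_irrelevance xy e1).
Qed.

End discretisation.

(** * The occupation estimate *)

Section occupation.
Variables (d : nat) (R : realType) (P : probability (Omega d R) R).
Hypothesis d_gt0 : (0 < d)%N.
Hypothesis P_invariant : forall (x : Zd d) (A : set (Omega d R)),
  measurable A -> P (theta x @^-1` A) = P A.
Hypothesis P_ge1 : forall e : edge d,
  {ae P, forall omega : Omega d R, 1 <= weight omega e}.
Variable g : R.
Hypothesis g_gt0 : 0 < g.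

Notation B := (Bop d_gt0 P_invariant g_gt0).
Notation phi := (@phi d R g).
Notation phi2 := (@phi2 d R g).
Let ipP := @ip_semi_inner_product _ _ _ P.

Variables (f h hh : L2 P) (M : R).
Hypothesis M_ge0 : 0 <= M.
Hypothesis Nf : (Nnorm P f < +oo)%E.
Hypothesis h_le : forall omega, `|h omega| <= `|f omega|.
Hypothesis h_rate : forall omega, h omega != 0 -> exit_rate omega 0 <= M.
Hypothesis hhE : forall omega, phi omega * hh omega = h omega.

Let N := fine (Nnorm P f).

Let hhV omega : hh omega = h omega / phi omega.
Proof. by rewrite -hhE mulrAC divff ?mul1r// gt_eqF// phi_gt0. Qed.

Let Mg_ge0 : 0 <= M / g. Proof. by rewrite divr_ge0// ltW. Qed.

Lemma rate_sqr_le omega :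
  exit_rate omega 0 / g * h omega ^+ 2 <= M / g * f omega ^+ 2.
Proof.
have [->|h0] := eqVneq (h omega) 0.
  by rewrite expr0n mulr0 mulr_ge0// sqr_ge0.
apply: ler_pM; rewrite ?sqr_ge0 ?divr_ge0 ?(ltW g_gt0)//.
- exact/ltW/exit_rate_gt0.
- by rewrite ler_pM2r ?invr_gt0// h_rate.
- by rewrite -[leLHS]real_normK ?num_real// -[leRHS]real_normK ?num_real// lerXn2r ?nnegrE.
Qed.

(** The sum of the X_e^2 multiplies by phi^2 pi/g, and phi hh = h vanishes where pi > M. This
    controls the error term of [sum_norm_iter_le]. *)
Lemma dirichlet_small : ip hh hh - ip hh (B hh) <= 2 * (M / g) * ip f f.
Proof.
apply: (le_trans (dirichlet_le _ _ _ _)); rewrite -mulrA ler_pM2l//.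
under eq_bigr do rewrite {1}/Xop mulL2_sym.
rewrite -(dot_sumr ipP) -(dotZl ipP).
have key omega : hh omega * (\sum_(e <- steps d)
   mulL2 (measurable_bond_phi d_gt0 g_gt0 e)
    (bond_phi_le1 d_gt0 g_gt0 e) (Xop d_gt0 g_gt0 e hh)) omega =
    exit_rate omega 0 / g * h omega ^+ 2.
  rewrite L2_sumE; under eq_bigr do rewrite !mulL2E mulrA -expr2 exprMn.
  rewrite -!mulr_suml sum_bond//.
  by rewrite -[in RHS]hhE exprMn; ring.
apply: le_ip => [w|w|].
- by rewrite key mulr_ge0 ?sqr_ge0 ?divr_ge0 ?(ltW g_gt0)//; exact/ltW/exit_rate_gt0.
- by rewrite L2ZE -mulrA -expr2 mulr_ge0// sqr_ge0.
by apply/aeW => w; rewrite key L2ZE -[leRHS]mulrA -expr2 rate_sqr_le.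
Qed.

(** The witness is h / phi^2, so that <hh, u> = <F, phi u>. Then [F] is exchanged for [f], whose box
    sums N(f) controls, at the price of an L^2 error. *)
Lemma weighted_close : exists F : L2 P, Phi d_gt0 g_gt0 F = hh /\
  ip (F - f) (F - f) <= 2 * ip (h - f) (h - f) + 2 * ((M / g) ^+ 2 * ip f f).
Proof.
pose Ff omega := (phi2 omega)^-1 * h omega.
have Ffh omega : `|Ff omega - h omega| <= M / g * `|f omega|.
  have [h0|h0] := eqVneq (h omega) 0.
    by rewrite /Ff h0 mulr0 subrr normr0 mulr_ge0.
  rewrite /Ff -{2}[h omega]mul1r -mulrBl normrM ler_pM//.
  have p1 := phi2_le1 d_gt0 g_gt0 omega; have p0 := phi2_gt0 d_gt0 g_gt0 omega.
  rewrite ger0_norm; last by rewrite subr_ge0 invf_ge1.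
  rewrite lerBlDl (le_trans (invphi2_le d_gt0 g_gt0 omega))// lerD2l.
  by rewrite ler_pM2r ?invr_gt0// h_rate.
have FfL : Ff \in Lfun P 2%:E.
  apply: (@Lfun2_dominated _ _ _ _ _ f (1 + M / g)); last 2 first.
  - exact: L2P.
  - move=> w; rewrite -[Ff w](subrK (h w)) mulrDl mul1r addrC.
    by apply: (le_trans (ler_normD _ _)); apply: lerD.
  apply: measurable_funM (L2_measurable h).
  rewrite (_ : (fun _ => _) = fun w => (phi w * phi w)^-1); last first.
    by apply/funext => w; rewrite -expr2 phi_sqr.
  apply: measurable_funV => [|w]; last by rewrite mulr_gt0// phi_gt0.
  by apply: measurable_funM; exact: measurable_phi.
exists (toL2 FfL); split.
  apply/LfuneqP => w; rewrite mulL2E /= /Ff hhV -phi_sqr// invfM.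
  by field; rewrite gt_eqF// phi_gt0.
have -> : toL2 FfL - f = (toL2 FfL - h) + (h - f) by rewrite addrA subrK.
apply: (le_trans (dot_addr_le ipP _ _)); rewrite addrC lerD2l ler_pM2l//.
rewrite -(dotZl ipP); apply: le_ip => [w|w|].
- by rewrite -expr2 sqr_ge0.
- by rewrite L2ZE -mulrA -expr2 mulr_ge0 ?sqr_ge0.
apply/aeW => w; rewrite L2ZE -mulrA -!expr2 -exprMn.
rewrite -[leLHS]real_normK ?num_real// -[leRHS]real_normK ?num_real//.
by rewrite lerXn2r ?nnegrE// normrM (ger0_norm Mg_ge0) L2DE L2NE Ffh.
Qed.

Lemma occupation_le (n K : nat) : (0 < n)%N ->
  \sum_(j < n) ip (iter j B hh) (iter j B hh) <=
    4 * g * (16 * d%:R ^+ 2 * scale_sum d R K * N) + 8 * n%:R * (N / 2 ^+ (K * d))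
    + 16 * n%:R * (ip (h - f) (h - f) + (M / g) ^+ 2 * ip f f)
    + 2 * n%:R * (M / g) * ip f f.
Proof.
move=> n0; have n1 : 0 < n%:R :> R by rewrite ltr0n.
have BD := BopD d_gt0 P_invariant g_gt0; have BZ := BopZ d_gt0 P_invariant g_gt0.
have Bsym := Bop_sym d_gt0 P_invariant g_gt0.
have Bge := Bop_ge d_gt0 P_invariant g_gt0; have Ble := Bop_le d_gt0 P_invariant g_gt0.
apply: (le_trans (sum_norm_iter_le ipP BD BZ Bsym Bge Ble hh n)).
have D1 := dirichlet_partial_sum_le ipP BD BZ Bsym Bge hh n.
have D2 := norm_partial_sum_le ipP BD BZ Bsym Bge Ble hh n.
set u := \sum_(j < n.*2) _ in D1 D2 *.
set A := ip hh u in D1 D2 *.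
rewrite (dotDr ipP) (dotNr ipP) in D1.
have A0 : 0 <= A by exact: le_trans (Ble u) D1.
have G := gradient_le_dirichlet d_gt0 P_invariant P_ge1 g_gt0 u.
set v := Phi d_gt0 g_gt0 u in G.
have vu : ip v v <= ip u u by exact: ip_mul_le.
have [F [FE Ff]] := weighted_close.
have AE : A = ip f v + ip (F - f) v.
  by rewrite -(dotDl ipP) addrC subrK /A -FE /v /Phi mulL2_sym.
(* With weights 4g and 8n the gradient of [v] contributes A/4, and its norm A/4 twice, in [MS] and
   in [Y]. These 3A/4 are absorbed by 2A, and A >= 0 allows keeping only A on the left. *)
have t1 : 0 < 4 * g by rewrite mulr_gt0.
have t2 : 0 < 8 * n%:R :> R by rewrite mulr_gt0.
have MS := multiscale_N P_invariant d_gt0 Nf K v t1 t2.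
have Y := dot_young ipP (F - f) v t2.
have dsmall := dirichlet_small.
rewrite (dotDr ipP) (dotNr ipP).
have E1 : (2 * (4 * g))^-1 * gradient_form (@ip _ _ _ P) (translate P_invariant) (steps d) v
    <= 4^-1 * A.
  rewrite mulrC ler_pdivrMr ?mulr_gt0//; apply: (le_trans G).
  have : 2 * g * (ip u u - ip u (B u)) <= 2 * g * A by rewrite ler_pM2l ?mulr_gt0.
  lra.
have E2 : (8 * n%:R)^-1 * ip v v <= 4^-1 * A.
  rewrite mulrC ler_pdivrMr//; apply: (le_trans vu); apply: (le_trans D2).
  by rewrite -muln2 natrM; lra.
rewrite -/N in MS.
have H3 : 8 * n%:R * ip (F - f) (F - f) <=
    8 * n%:R * (2 * ip (h - f) (h - f) + 2 * ((M / g) ^+ 2 * ip f f)).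
  by rewrite ler_pM2l.
have H4 : n%:R * (ip hh hh - ip hh (B hh)) <= n%:R * (2 * (M / g) * ip f f).
  by rewrite ler_pM2l.
move: MS Y H3 H4 E1 E2 AE.
set s1 := 4 * g * _; set s2 := _ * (N / _); set s3 := _ ^+ 2 * ip f f.
move: (ip (F - f) v) (ip f v) (ip v v) (ip (F - f) (F - f)) (ip (h - f) (h - f))
  (gradient_form _ _ _ _) (ip hh hh - ip hh (B hh)).
move=> x1 x2 x3 x4 x5 x6 x7; move: (8 * n%:R)^-1 (2 * (4 * g))^-1 => i1 i2.
move=> MS Y H3 H4 E1 E2 AE.
move: (i1 * x3) (i2 * x6) MS Y E1 E2 => a1 a2 MS Y E1 E2.
lra.
Qed.

Lemma hh_norm_le : ip hh hh <= (1 + M / g) * ip f f.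
Proof.
rewrite -(dotZl ipP); apply: le_ip => [w|w|].
- by rewrite -expr2 sqr_ge0.
- by rewrite L2ZE -mulrA -expr2 mulr_ge0 ?sqr_ge0// addr_ge0.
apply/aeW => w; rewrite L2ZE -mulrA -!expr2 hhV exprMn exprVn phi_sqr//.
have [->|h0] := eqVneq (h w) 0.
  by rewrite expr0n mul0r mulr_ge0 ?sqr_ge0// addr_ge0.
rewrite mulrC; apply: ler_pM; rewrite ?sqr_ge0 ?invr_ge0 ?(ltW (phi2_gt0 _ _ _))//.
  rewrite (le_trans (invphi2_le d_gt0 g_gt0 w))// lerD2l.
  by rewrite ler_pM2r ?invr_gt0// h_rate.
by rewrite -[leLHS]real_normK ?num_real// -[leRHS]real_normK ?num_real// lerXn2r ?nnegrE.
Qed.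

End occupation.

(** * The walk on a time grid *)

Definition upd T (y : nat -> T) n z i := if i == n then z else y i.

Lemma updxx T (y : nat -> T) n z : upd y n z n = z.
Proof. by rewrite /upd eqxx. Qed.

Section walk_paths.
Variables (d : nat) (R : realType) (dW : measure_display) (W : measurableType dW).
Variables (Y : nat -> W -> Zd d) (S : nat -> W -> R).

Lemma jump_time_nd w : (forall i, 0 <= S i w) ->
  {homo (fun n => jump_time S n w) : m n / (m <= n)%N >-> m <= n}.
Proof.
move=> S0 m n /subnK <-; elim: (n - m)%N => [|k IH]; first by rewrite add0n.
by apply: le_trans IH _; rewrite addSn /jump_time big_ord_recr/= lerDl.
Qed.

Lemma walkE t w n : (forall i, 0 <= S i w) ->
  jump_time S n w <= t < jump_time S n.+1 w -> walk Y S t w = Y n w.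
Proof.
move=> S0 nt; congr (Y _ w); apply: xget_unique => // m /andP[mt1 mt2].
move: nt => /andP[nt1 nt2].
have [mn|nm|//] := ltngtP m n.
  have := lt_le_trans mt2 (jump_time_nd S0 mn).
  by rewrite ltNge nt1.
have := lt_le_trans nt2 (jump_time_nd S0 nm).
by rewrite ltNge mt1.
Qed.

End walk_paths.

Lemma measurable_fibers dW (W : measurableType dW) dT (T : measurableType dT)
    (I : countType) (Z : W -> I) (h : I -> T) :
  (forall i, measurable (Z @^-1` [set i])) ->
  measurable_fun setT (fun w => h (Z w)).
Proof.
move=> mZ _ A mA; rewrite setTI.
have -> : (fun w => h (Z w)) @^-1` A =
    \bigcup_i (if h i \in A then Z @^-1` [set i] else set0).
  apply/seteqP; split=> [w Aw|w [i _]].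
    by exists (Z w) => //; rewrite ifT//; exact/mem_set.
  by case: ifPn => // /set_mem hi /= ->.
apply: countable_bigcupT_measurable => [|i]; first exact: countableP.
by case: ifP.
Qed.

Section measurable_walk.
Variables (d : nat) (R : realType) (dW : measure_display) (W : measurableType dW).
Variables (Y : nat -> W -> Zd d) (S : nat -> W -> R).
Hypothesis mY : forall n y, measurable (Y n @^-1` [set y]).
Hypothesis mS : forall n, measurable_fun setT (S n).
Hypothesis S_ge0 : forall n w, 0 <= S n w.

Lemma measurable_jump_time n : measurable_fun setT (fun w => jump_time S n w).
Proof. by apply: measurable_sum => i; exact: mS. Qed.

Lemma measurable_walk t z : measurable (walk Y S t @^-1` [set z]).
Proof.
pose J n := [set w | jump_time S n w <= t < jump_time S n.+1 w].
have mJ n : measurable (J n).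
  have -> : J n = [set w | jump_time S n w <= t] `&` [set w | t < jump_time S n.+1 w].
    by apply/seteqP; split => w; [move=> /andP[]|move=> [? ?]; apply/andP].
  apply: measurableI; rewrite -[X in measurable X]setTI.
    rewrite (_ : [set w | _] = jump_time S n @^-1` `]-oo, t]%classic).
      exact: (measurable_jump_time n measurableT (measurable_itv `]-oo, t])).
    by apply/seteqP; split=> w; rewrite /= in_itv.
  rewrite (_ : [set w | _] = jump_time S n.+1 @^-1` `]t, +oo[%classic).
    exact: (measurable_jump_time n.+1 measurableT (measurable_itv `]t, +oo[)).
  by apply/seteqP; split=> w; rewrite /= in_itv/= andbT.
(* Where no index qualifies, [xget] returns 0 and the walk takes the value of [Y 0]; the second set
   covers that default. *)
have -> : walk Y S t @^-1` [set z] = \bigcup_n (J n `&` Y n @^-1` [set z])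
    `|` (~` (\bigcup_n J n) `&` Y 0%N @^-1` [set z]).
  apply/seteqP; split=> w /=.
    have [[n Jn]|nJ] := pselect (exists n, J n w).
      rewrite (walkE _ (fun i => S_ge0 i w) Jn) => Yn; left; exists n => //.
    rewrite /walk xgetPN => [Y0|n Jn]; last by apply: nJ; exists n.
    by right; split => // -[n _ Jn]; apply: nJ; exists n.
  case=> [[n _ [Jn Yn]]|[nJ Y0]].
    by rewrite (walkE _ (fun i => S_ge0 i w) Jn).
  by rewrite /walk xgetPN// => n Jn; apply: nJ; exists n.
apply: measurableU; first by apply: bigcup_measurable => n _; exact: measurableI.
by apply: measurableI => //; apply/measurableC/bigcup_measurable.
Qed.

End measurable_walk.

Section chain_law.
Variables (d : nat) (R : realType) (dW : measure_display) (W : measurableType dW).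
Variable Q : Omega d R -> Zd d -> probability W R.
Variables (Y : nat -> W -> Zd d) (S : nat -> W -> R).
Hypothesis Q_walk : jump_chain_holding_times Q Y S.
Variable g : R.
Hypothesis g_gt0 : 0 < g.

Let S_gt0 n w : 0 < S n w. Proof. exact: holding_gt0 Q_walk n w. Qed.

(** Rounding up keeps every holding time at least one grid step and makes it geometric: exceeding l
    means S i > l/g, of probability q^l at a site of staying probability q. *)
Definition grid_holding i w : nat := absz (Num.ceil (g * S i w)).
Notation D := grid_holding.

Lemma lt_grid_holding l i w : (l < D i w)%N = (l%:R < g * S i w).
Proof.
rewrite -[l%:R]/(l%:Z%:~R) -ceil_gt_int -ltz_nat gez0_abs//.
by rewrite ltW// ceil_gt0 mulr_gt0.
Qed.

Lemma grid_holding_gt0 i w : (0 < D i w)%N.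
Proof. by rewrite lt_grid_holding mulr_gt0. Qed.

Lemma measurable_grid_holding_gt l i : measurable [set w | (l < D i w)%N].
Proof.
have mg : measurable_fun setT (fun w => g * S i w).
  by apply: measurable_funM => //; exact: holding_measurable Q_walk i.
rewrite (_ : [set w | _] = (fun w => g * S i w) @^-1` `]l%:R, +oo[%classic).
  by rewrite -[X in measurable X]setTI; exact: (mg measurableT _ (measurable_itv `]l%:R, +oo[)).
by apply/seteqP; split=> w; rewrite /= in_itv/= andbT lt_grid_holding.
Qed.

Lemma measurable_grid_holding i l : measurable (D i @^-1` [set l]).
Proof.
case: l => [|l].
  rewrite (_ : _ @^-1` _ = set0)//; apply/seteqP; split=> w //= Dw.
  by have := grid_holding_gt0 i w; rewrite Dw.
rewrite (_ : _ @^-1` _ = [set w | (l < D i w)%N] `\` [set w | (l.+1 < D i w)%N]).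
  by apply: measurableD; exact: measurable_grid_holding_gt.
by apply/seteqP; split=> w /=; [move=> ->; split; lia|move=> [? ?]; lia].
Qed.

Definition grid_walk j w : Zd d :=
  walk Y (fun i w => (D i w)%:R : R) j%:R w.
Notation Z := grid_walk.

Lemma measurable_grid_walk j z : measurable (Z j @^-1` [set z]).
Proof.
apply: measurable_walk => [n y|n|n w]; last exact: ler0n.
  exact: jump_chain_measurable Q_walk n y.
apply: (@measurable_fibers _ _ _ _ nat (D n) (fun k => k%:R : R)).
exact: measurable_grid_holding.
Qed.

Variables (omega : Omega d R) (x : Zd d).
Notation mu := (Q omega x).
Notation rate := (exit_rate omega).
Implicit Types (n m : nat) (y : nat -> Zd d) (s : nat -> nat) (e : Zd d).

Definition jump_prob z z' := conductance omega z z' / rate z.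
Definition stay_prob z := expR (- (rate z / g)).
Notation J := jump_prob.
Notation q := stay_prob.

(** Cylinders of the rounded chain in which the first m holding times are exact and the others, up
    to n, only bounded below. The parameter m carries an induction from the given law, m = 0, to m =
    n, where the position at a grid time is determined. *)
Definition history n m y s : set W :=
  [set w | (forall i, (i <= n)%N -> Y i w = y i /\ (s i < D i w)%N) /\
           (forall i, (i < m)%N -> D i w = (s i).+1)].

Definition history_prob n m y s : R :=
  (y 0 == x)%:R * \prod_(i < n) J (y i) (y i.+1) *
  \prod_(i < n.+1) (q (y i) ^+ s i * (if (i < m)%N then 1 - q (y i) else 1)).

Lemma measurable_history n m y s : measurable (history n m y s).
Proof.
have -> : history n m y s =
    (\bigcap_(i in [set i | (i <= n)%N]) (Y i @^-1` [set y i] `&` [set w | (s i < D i w)%N]))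
    `&` (\bigcap_(i in [set i | (i < m)%N]) D i @^-1` [set (s i).+1]).
  by apply/seteqP; split.
apply: measurableI; apply: bigcap_measurableType => i _.
  apply: measurableI; last exact: measurable_grid_holding_gt.
  exact: jump_chain_measurable Q_walk i _.
exact: measurable_grid_holding.
Qed.

Lemma history_law n m y s : (m <= n.+1)%N ->
  mu (history n m y s) = (history_prob n m y s)%:E.
Proof.
elim: m s => [|m IH] s mn.
  have := @jump_holding_law _ _ _ _ _ _ _ Q_walk omega x n y (fun i => (s i)%:R / g).
  rewrite (_ : [set w | _] = history n 0 y s); last first.
    apply/seteqP; split=> w /=.
      move=> h; split=> // i /h [-> sS]; split=> //.
      by rewrite lt_grid_holding mulrC -ltr_pdivrMr.
    move=> [h _] i /h [-> sD]; split=> //.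
    by rewrite ltr_pdivrMr// mulrC -lt_grid_holding.
  move=> -> => [|i]; last by rewrite divr_ge0// ltW.
  congr (_ * _)%:E; apply: eq_bigr => i _; rewrite mulr1 -expRM_natl.
  by congr expR; ring.
(* Raising the m-th threshold by one: D_m = s_m + 1 is D_m > s_m deprived of D_m > s_m + 1. *)
pose s' := upd s m (s m).+1.
have -> : history n m.+1 y s = history n m y s `\` history n m y s'.
  apply/seteqP; split=> w.
    move=> [h1 h2]; split; first by split=> // i im; exact/h2/ltnW.
    move=> [h3 _]; have [_] := h3 m mn; rewrite /s' /upd eqxx h2//.
    by rewrite ltnn.
  move=> [[h1 h2] nh]; split=> // i; rewrite ltnS leq_eqVlt => /orP[/eqP ->|im]; last exact: h2.
  have [_ sD] := h1 m mn; apply/eqP; rewrite eqn_leq sD andbT leqNgt.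
  apply/negP => sD'; apply: nh; split=> [j jn|j jm].
    by rewrite /s' /upd; case: eqP => [->|_]; [split; [exact: (h1 m mn).1|]|exact: h1].
  by rewrite /s' /upd ltn_eqF//; exact: h2.
rewrite measureD; [|exact: measurable_history|exact: measurable_history|].
  have -> : history n m y s `&` history n m y s' = history n m y s'.
    apply/setIidPr => w [h1 h2]; split=> [j jn|j jm].
      have [? sD] := h1 j jn; split=> //; move: sD; rewrite /s' /upd.
      by case: eqP => [->|//]; exact: ltnW.
    by rewrite h2// /s' /upd ltn_eqF.
  transitivity ((history_prob n m y s)%:E - (history_prob n m y s')%:E)%E.
    by congr (_ - _)%E; exact/IH/ltnW.
  rewrite -EFinB; congr EFin.
  rewrite /history_prob -mulrBr; congr (_ * _).
  pose k := Ordinal mn.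
  rewrite (bigD1 k)//= [X in _ - X](bigD1 k)//= [RHS](bigD1 k)//=.
  rewrite ltnn ltnSn !mulr1.
  have e1 : \prod_(i < n.+1 | i != k) (q (y i) ^+ s' i * (if (i < m)%N then 1 - q (y i) else 1)) =
            \prod_(i < n.+1 | i != k) (q (y i) ^+ s i * (if (i < m)%N then 1 - q (y i) else 1)).
    apply: eq_bigr => i ik; rewrite /s' /upd ifF//.
    by apply: contraNF ik => /eqP im; apply/eqP/val_inj.
  have e2 : \prod_(i < n.+1 | i != k) (q (y i) ^+ s i * (if (i < m.+1)%N then 1 - q (y i) else 1)) =
            \prod_(i < n.+1 | i != k) (q (y i) ^+ s i * (if (i < m)%N then 1 - q (y i) else 1)).
    apply: eq_bigr => i ik; rewrite ltnS leq_eqVlt.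
    suff -> : (val i == m) = false by [].
    by apply: contraNF ik => /eqP im; apply/eqP/val_inj.
  rewrite e1 e2 -mulrBl; congr (_ * _).
  by rewrite /s' /upd eqxx exprS; ring.
by rewrite (le_lt_trans (probability_le1 _ (measurable_history _ _ _ _)))// ltry.
Qed.

End chain_law.

(* [integral_cst] with the measure printed through the coercion from
   [probability], so that the law of the chain can be rewritten in the result. *)
Lemma integral_cst_probability dW (W : measurableType dW) (R : realType)
    (mu : probability W R) (A : set W) (c : \bar R) :
  measurable A -> (\int[mu]_(w in A) cst c w = c * mu A)%E.
Proof. by move=> mA; rewrite integral_cst. Qed.

Section chain_markov.
Variables (d : nat) (R : realType) (dW : measure_display) (W : measurableType dW).
Hypothesis d_gt0 : (0 < d)%N.
Variable Q : Omega d R -> Zd d -> probability W R.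
Variables (Y : nat -> W -> Zd d) (S : nat -> W -> R).
Hypothesis Q_walk : jump_chain_holding_times Q Y S.
Variable g : R.
Hypothesis g_gt0 : 0 < g.
Variables (omega : Omega d R) (x : Zd d).
Notation mu := (Q omega x).
Implicit Types (n m : nat) (y : nat -> Zd d) (s : nat -> nat) (e : Zd d).
Notation J := (jump_prob omega).
Notation q := (stay_prob g omega).
Notation D := (grid_holding S g).
Notation Z := (grid_walk Y S g).
Notation history := (history Y S g).
Notation history_prob := (history_prob g omega x).

Lemma sum_jump_prob z : \sum_(e <- steps d) J z (z + e) = 1.
Proof.
by rewrite -mulr_suml -exit_rateE divff// gt_eqF// exit_rate_gt0.
Qed.

Definition chain_step (h : Zd d -> R) z : R :=
  q z * h z + \sum_(e <- steps d) (1 - q z) * J z (z + e) * h (z + e).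

(** The grid time up to which [history n n y s] describes the chain: it has then spent [s n] steps
    at [y n] and is still there. *)
Definition elapsed n s : nat := (\sum_(i < n) (s i).+1 + s n)%N.

Lemma grid_walk_history n y s w : history n n y s w -> Z (elapsed n s) w = y n.
Proof.
move=> [h1 h2]; have [Yn sD] := h1 n (leqnn n); rewrite -Yn; apply: walkE.
  by move=> i; exact: ler0n.
have jt : jump_time (fun i w => (D i w)%:R : R) n w = (\sum_(i < n) (s i).+1)%:R.
  by rewrite /jump_time natr_sum; apply: eq_bigr => i _; rewrite h2.
rewrite /jump_time big_ord_recr/= -/(jump_time (fun i w => (D i w)%:R : R) n w).
by rewrite jt -natrD ler_nat ltr_nat leq_addr ltn_add2l.
Qed.

Lemma history_prob_recr n y s : history_prob n n y s =
  (y 0 == x)%:R * \prod_(i < n) J (y i) (y i.+1) *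
  \prod_(i < n) (q (y i) ^+ s i * (1 - q (y i))) * q (y n) ^+ s n.
Proof.
rewrite /history_prob big_ord_recr/= ltnn mulr1 mulrA; congr (_ * _ * _).
by apply: eq_bigr => i _; rewrite ltn_ord.
Qed.

Lemma history_prob_stay n y s :
  history_prob n n y (upd s n (s n).+1) = history_prob n n y s * q (y n).
Proof.
rewrite !history_prob_recr updxx exprSr !mulrA; congr (_ * _ * _ * _).
by apply: eq_bigr => i _; rewrite /upd ltn_eqF.
Qed.

Lemma history_prob_move n y s e :
  history_prob n.+1 n.+1 (upd y n.+1 (y n + e)) (upd s n.+1 0%N) =
  history_prob n n y s * ((1 - q (y n)) * J (y n) (y n + e)).
Proof.
rewrite !history_prob_recr.
have uy i : (i <= n)%N -> upd y n.+1 (y n + e) i = y i.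
  by move=> le_in; rewrite /upd ltn_eqF.
have us i : (i <= n)%N -> upd s n.+1 0%N i = s i.
  by move=> le_in; rewrite /upd ltn_eqF.
rewrite !updxx expr0 mulr1 (uy 0%N)// !big_ord_recr/=.
rewrite !(uy n (leqnn n)) !(us n (leqnn n)) !updxx.
have -> : \prod_(i < n) J (upd y n.+1 (y n + e) i) (upd y n.+1 (y n + e) i.+1) =
          \prod_(i < n) J (y i) (y i.+1).
  by apply: eq_bigr => i _; rewrite !uy// ltnW.
have -> : \prod_(i < n) (q (upd y n.+1 (y n + e) i) ^+ upd s n.+1 0%N i *
    (1 - q (upd y n.+1 (y n + e) i))) = \prod_(i < n) (q (y i) ^+ s i * (1 - q (y i))).
  by apply: eq_bigr => i _; rewrite uy ?us// ltnW.
by ring.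
Qed.

Let hist_stay n y s := history n n y (upd s n (s n).+1).
Let hist_move n y s e := history n.+1 n.+1 (upd y n.+1 (y n + e)) (upd s n.+1 0%N).

Let stay_sub n y s : hist_stay n y s `<=` history n n y s.
Proof.
move=> w [h1 h2]; split=> [i le_in|i lt_in].
  have [? sD] := h1 i le_in; split=> //; move: sD.
  by rewrite /upd; case: eqP => [->|//]; exact: ltnW.
by rewrite h2// /upd ltn_eqF.
Qed.

Let move_D n y s e w : hist_move n y s e w -> D n w = (s n).+1.
Proof. by move=> [_ h2]; rewrite h2// /upd ltn_eqF. Qed.

Let move_Y n y s e w : hist_move n y s e w -> Y n.+1 w = y n + e.
Proof. by move=> [/(_ n.+1 (leqnn _)) [-> _]]; rewrite /upd eqxx. Qed.

Let move_sub n y s e : hist_move n y s e `<=` history n n y s.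
Proof.
move=> w [h1 h2]; split=> [i le_in|i lt_in].
  have [-> _] := h1 i (leqW le_in); split; first by rewrite /upd ltn_eqF.
  by rewrite h2// /upd ltn_eqF.
have lt_in1 : (i < n.+1)%N by exact: leqW.
by rewrite h2// /upd ltn_eqF.
Qed.

Let moves n y s := \big[setU/set0]_(e <- steps d) hist_move n y s e.

Let moves_D n y s w : moves n y s w -> D n w = (s n).+1.
Proof.
rewrite /moves; elim: (steps d) => [|e l IH]; first by rewrite big_nil.
by rewrite big_cons => -[/move_D|].
Qed.

Let moves_sub n y s : moves n y s `<=` history n n y s.
Proof.
rewrite /moves; elim: (steps d) => [|e l IH]; first by rewrite big_nil.
by rewrite big_cons => w [/move_sub|/IH].
Qed.

Let m_hist n m y s : measurable (history n m y s).
Proof. exact: (measurable_history Q_walk g_gt0). Qed.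

Let m_moves n y s : measurable (moves n y s).
Proof. by apply: bigsetU_measurable => e _; exact: m_hist. Qed.

Let triv_moves n y s : trivIset [set` steps d] (hist_move n y s).
Proof.
move=> e e' _ _ [w [/move_Y h /move_Y h']].
by apply: (@addrI _ (y n)); rewrite -h -h'.
Qed.

Let stay_moves n y s : [disjoint hist_stay n y s & moves n y s].
Proof.
apply/disj_set2P/seteqP; split=> // w [[h1 _] /moves_D Dn].
by have [_] := h1 n (leqnn n); rewrite /upd eqxx Dn ltnn.
Qed.

(** In one more grid step the chain stays or moves to a neighbour. Other jumps are excluded only
    almost surely: the pieces exhaust the mass of the history because [sum_jump_prob] is 1. *)
Lemma history_integral_split n y s (F : W -> \bar R) :
  measurable_fun setT F -> (forall w, 0 <= F w)%E ->
  (\int[mu]_(w in history n n y s) F w =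
   \int[mu]_(w in hist_stay n y s) F w +
   \sum_(e <- steps d) \int[mu]_(w in hist_move n y s e) F w)%E.
Proof.
pose U := hist_stay n y s `|` moves n y s.
have mU : measurable U by apply: measurableU; [exact: m_hist|exact: m_moves].
have US : U `<=` history n n y s by move=> w [/stay_sub|/moves_sub].
have splitU (H : W -> \bar R) : measurable_fun setT H -> (forall w, 0 <= H w)%E ->
   (\int[mu]_(w in U) H w = \int[mu]_(w in hist_stay n y s) H w +
    \sum_(e <- steps d) \int[mu]_(w in hist_move n y s e) H w)%E.
  move=> mH H0; rewrite ge0_integral_setU//; [|exact: m_hist|exact: measurable_funTS].
  rewrite ge0_integral_bigsetU//; [by move=> e; exact: m_hist|exact: uniq_steps|].
  exact: measurable_funTS.
move=> mF F0; rewrite -splitU//.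
have muU : mu U = mu (history n n y s).
  have := splitU (cst 1%E) (measurable_cst _) (fun=> lee01).
  have cst1 A : measurable A -> (\int[mu]_(w in A) cst 1 w = mu A)%E.
    by move=> mA; rewrite integral_cst_probability// mul1e.
  rewrite (cst1 _ mU) (cst1 _ (m_hist _ _ _ _)) => ->.
  under eq_bigr do rewrite (cst1 _ (m_hist _ _ _ _)) (history_law Q_walk g_gt0)//
    history_prob_move.
  rewrite !(history_law Q_walk g_gt0)// history_prob_stay.
  rewrite sumEFin -EFinD; congr EFin.
  rewrite -mulr_sumr -mulr_sumr sum_jump_prob; ring.
have null : mu (history n n y s `\` U) = 0%E.
  rewrite measureD//; last by rewrite -ge0_fin_numE// fin_num_measure.
  rewrite (setIidr US); transitivity (mu (history n n y s) - mu U)%E => //.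
  by rewrite muU subee// fin_num_measure.
rewrite (ge0_negligible_integral (measurableD (m_hist n n y s) mU))//.
  by rewrite setDD (setIidr US).
exact: measurable_funTS.
Qed.

(** The Markov property after a given history. Both kinds of pieces in the split are again
    histories, observed one grid step later with one step less to go. *)
Lemma history_integral r n y s h : (forall z, 0 <= h z) ->
  (\int[mu]_(w in history n n y s) (h (Z (elapsed n s + r) w))%:E =
   (history_prob n n y s * iter r chain_step h (y n))%:E)%E.
Proof.
move=> h0; elim: r n y s => [|r IH] n y s.
  rewrite addn0 (eq_integral (cst (h (y n))%:E)); last first.
    by move=> w /set_mem/grid_walk_history ->.
  by rewrite integral_cst_probability// (history_law Q_walk g_gt0)// -EFinM mulrC.
rewrite history_integral_split; last 2 first.
- apply/measurable_EFinP; apply: (@measurable_fibers _ _ _ _ _ (Z (elapsed n s + r.+1)) h).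
  exact: (measurable_grid_walk Q_walk g_gt0).
- by move=> w; rewrite lee_fin.
have eS : (elapsed n s + r.+1 = elapsed n (upd s n (s n).+1) + r)%N.
  rewrite /elapsed addnS -addSn; congr (_ + _)%N; rewrite -addnS updxx.
  by congr (_ + _)%N; apply: eq_bigr => i _; rewrite /upd ltn_eqF.
have eM : (elapsed n s + r.+1 = elapsed n.+1 (upd s n.+1 0) + r)%N.
  rewrite /elapsed addnS -addSn; congr (_ + _)%N.
  rewrite big_ord_recr/= updxx addn0 {2}/upd ltn_eqF// addnS; congr (_ + _).+1.
  apply: eq_bigr => i _; rewrite /upd ltn_eqF//; exact: leqW (ltn_ord i).
rewrite {1}eS IH history_prob_stay.
under eq_bigr do rewrite eM IH history_prob_move updxx.
rewrite sumEFin -EFinD; congr EFin; rewrite iterS /chain_step mulrDr mulrA; congr (_ + _).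
by rewrite mulr_sumr; apply: eq_bigr => e _; rewrite !mulrA.
Qed.

Lemma grid_walk_law r h : (forall z, 0 <= h z) ->
  (\int[mu]_w (h (Z r w))%:E = (iter r chain_step h x)%:E)%E.
Proof.
move=> h0; have := history_integral r 0 (fun=> x) (fun=> 0%N) h0.
have -> : elapsed 0 (fun=> 0%N) = 0%N by rewrite /elapsed big_ord0.
have p1 : history_prob 0 0 (fun=> x) (fun=> 0%N) = 1.
  by rewrite history_prob_recr !big_ord0 eqxx expr0 !mulr1.
rewrite p1 mul1r add0n => <-.
set H := history 0 0 _ _; have mH : measurable H by exact: m_hist.
have muH : mu H = 1%E by rewrite (history_law Q_walk g_gt0)// p1.
have null : mu (~` H) = 0%E by rewrite probability_setC// muH subee.
rewrite (ge0_negligible_integral (measurableC mH))//.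
- by rewrite setTD setCK.
- apply/measurable_EFinP; apply: (@measurable_fibers _ _ _ _ _ (Z r) h).
  exact: (measurable_grid_walk Q_walk g_gt0).
- by move=> w _; rewrite lee_fin.
Qed.

End chain_markov.

(** * The continuous-time limit *)

Section limn_einf_extra.
Local Open Scope ereal_scope.
Variable R : realType.
Implicit Types u v : (\bar R)^nat.

Lemma le_limn_einf u v : (forall n, u n <= v n) -> limn_einf u <= limn_einf v.
Proof.
move=> uv; rewrite !limn_einf_lim; apply: lee_lim; [exact: is_cvg_einfs|exact: is_cvg_einfs|].
apply: nearW => n; apply: le_ereal_inf_tmp => _ [k /= nk <-].
by apply: le_trans (uv k); apply: ereal_inf_lbound; exists k.
Qed.

Lemma limn_einf_ge0 u : (forall n, 0 <= u n) -> 0 <= limn_einf u.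
Proof.
move=> u0; have := @le_limn_einf (fun=> 0) u u0.
by rewrite (cvg_limn_einf_sup (cvg_cst 0)).1.
Qed.

Lemma measurable_limn_einf dT (T : measurableType dT) (D : set T)
    (f : (T -> \bar R)^nat) : (forall n, measurable_fun D (f n)) ->
  measurable_fun D (fun x => limn_einf (f ^~ x)).
Proof.
move=> mf; rewrite /limn_einf.
apply: measurableT_comp => //; apply: measurable_fun_limn_esup => n.
by apply: measurableT_comp => //; exact: mf.
Qed.

End limn_einf_extra.

Section outer_integral.
Import HBNNSimple.

(* Needed for [semigroup], which may fail to be measurable in the environment:
   [Q] is arbitrary in [omega]. *)
Lemma ge0_outer_le_integral dT (T : measurableType dT) (R : realType)
    (mu : {measure set T -> \bar R}) (D : set T) (f h : T -> \bar R) :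
  measurable D -> measurable_fun D h ->
  (forall x, D x -> 0 <= f x)%E -> (forall x, D x -> 0 <= h x)%E ->
  {ae mu, forall x, D x -> f x <= h x}%E ->
  (\int[mu]_(x in D) f x <= \int[mu]_(x in D) h x)%E.
Proof.
move=> mD mh f0 h0 fh; rewrite ge0_integralE//.
apply: ge_ereal_sup => _ [k kf <-]; rewrite -integralT_nnsfun.
rewrite [leRHS]integral_mkcond; apply: ae_ge0_le_integral => //.
- by move=> x _; rewrite lee_fin.
- exact/measurable_EFinP.
- by move=> x _; exact: erestrict_ge0.
- by apply/(measurable_restrictT _ mD).
apply: filterS fh => x fhx _; apply: (le_trans (kf x)).
by rewrite !patchE; case: ifPn => // /set_mem; exact: fhx.
Qed.

End outer_integral.

Section env_chain.
Variables (d : nat) (R : realType).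
Hypothesis d_gt0 : (0 < d)%N.
Variable g : R.
Hypothesis g_gt0 : 0 < g.
Implicit Types (f h : Omega d R -> R) (omega : Omega d R).

Definition env_step f omega : R :=
  stay g omega * f omega + \sum_(e <- steps d)
    (1 - stay g omega) * (conductance omega 0 e / exit_rate omega 0) * f (theta e omega).

(** The rates at a site [y] of [omega] are those at the origin of [theta y omega]: moving the walker
    amounts to moving the environment. *)
Lemma iter_chain_step_theta r f omega x :
  iter r (chain_step g omega) (fun y => f (theta y omega)) x =
  iter r env_step f (theta x omega).
Proof.
elim: r x => // r IH x; rewrite !iterS /chain_step /env_step IH.
rewrite /stay_prob /stay /jump_prob exit_rate_theta addr0; congr (_ + _).
apply: eq_bigr => e _.
by rewrite IH conductance_theta addr0 theta_comp.
Qed.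

Lemma measurable_iter_env_step r f :
  measurable_fun setT f -> measurable_fun setT (iter r env_step f).
Proof.
move=> mf; elim: r => // r IH; rewrite iterS; apply: measurable_funD.
  by apply: measurable_funM => //; exact: measurable_stay.
apply: measurable_sum => e; apply: measurable_funM; last first.
  exact: measurableT_comp IH (measurable_theta e).
apply: measurable_funM.
  by apply: measurable_funB => //; exact: measurable_stay.
apply: measurable_funM; first exact: measurable_conductance.
apply: measurable_funV; first exact: measurable_exit_rate.
by move=> o; exact: exit_rate_gt0.
Qed.

Lemma env_stepB f h : env_step (f \- h) = env_step f \- env_step h.
Proof.
apply/funext => o; rewrite /env_step /= mulrBr opprD addrACA -sumrB; congr (_ + _).
by apply: eq_bigr => e _; rewrite mulrBr.
Qed.

Lemma iter_env_stepB r f h :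
  iter r env_step (f \- h) = iter r env_step f \- iter r env_step h.
Proof. by elim: r => // r IH; rewrite !iterS IH env_stepB. Qed.

Section symmetrised.
Variable P : probability (Omega d R) R.
Hypothesis P_invariant : forall (x : Zd d) (A : set (Omega d R)),
  measurable A -> P (theta x @^-1` A) = P A.
Notation B := (Bop d_gt0 P_invariant g_gt0).

(* [env_step] is symmetric for the weight [phi ^- 2], not for [P]; conjugating
   by [phi] turns it into [Bop]. *)
Lemma iter_env_step_phi r f (u : L2 P) :
  (forall omega, phi g omega * u omega = f omega) ->
  forall omega, iter r env_step f omega = phi g omega * iter r B u omega.
Proof.
move=> uf; elim: r => [|r IH] omega; first by rewrite uf.
rewrite !iterS /env_step /Bop IH; set v := iter r _ u.
rewrite L2DE L2_sumE !mulL2E [_ * (_ * v omega)]mulrA -expr2 sqr_sqrtr ?expR_ge0//.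
rewrite mulrDr mulrCA mulr_sumr; congr (_ + _); apply: eq_bigr => e _.
rewrite IH !mulL2E /=.
rewrite -(phi2_rate d_gt0 g_gt0) -(phi_sqr d_gt0 g_gt0).
have -> : phi g omega ^+ 2 * (exit_rate omega 0 / g) *
    (conductance omega 0 e / exit_rate omega 0) =
    phi g omega ^+ 2 * bond g e omega ^+ 2.
  rewrite bond_sqr//; field.
  by rewrite (gt_eqF (exit_rate_gt0 omega 0 d_gt0)) gt_eqF.
by ring.
Qed.

End symmetrised.

Section quenched.
Variables (dW : measure_display) (W : measurableType dW).
Variable Q : Omega d R -> Zd d -> probability W R.
Variables (Y : nat -> W -> Zd d) (S : nat -> W -> R).
Hypothesis Q_walk : jump_chain_holding_times Q Y S.
Notation Z := (grid_walk Y S g).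

Lemma measurable_grid_fun r f omega :
  measurable_fun setT (fun w => f (theta (Z r w) omega)).
Proof.
apply: (@measurable_fibers _ _ _ _ _ (Z r) (fun z => f (theta z omega))).
exact: (measurable_grid_walk Q_walk g_gt0 r).
Qed.

Lemma ge0_grid_integral r f omega : (forall o, 0 <= f o) ->
  (\int[Q omega 0]_w (f (theta (Z r w) omega))%:E = (iter r env_step f omega)%:E)%E.
Proof.
move=> f0; have := grid_walk_law d_gt0 Q_walk g_gt0 omega 0 r
  (h := fun z => f (theta z omega)) (fun z => f0 _).
by rewrite iter_chain_step_theta theta0.
Qed.

(** The positive and negative parts have finite means, namely the real numbers given by iterating
    [env_step], so the signed integral splits. *)
Lemma grid_integral r f omega :
  (\int[Q omega 0]_w (f (theta (Z r w) omega))%:E = (iter r env_step f omega)%:E)%E.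
Proof.
pose f1 o := Num.max (f o) 0; pose f2 o := Num.max (- f o) 0.
have f10 o : 0 <= f1 o by rewrite le_max lexx orbT.
have f20 o : 0 <= f2 o by rewrite le_max lexx orbT.
have -> : f = f1 \- f2.
  apply/funext => o; rewrite /f1 /f2 /=.
  by case: (lerP (f o) 0) => h; case: (lerP (- f o) 0) => h'; lra.
have int h : (forall o, 0 <= h o) ->
    (Q omega 0).-integrable setT (fun w => (h (theta (Z r w) omega))%:E).
  move=> h0; apply/integrableP; split.
    exact/measurable_EFinP/measurable_grid_fun.
  under eq_integral do rewrite gee0_abs ?lee_fin//.
  by rewrite ge0_grid_integral// ltry.
under eq_integral do rewrite EFinB.
rewrite integralB//; [|exact: int|exact: int].
by rewrite !ge0_grid_integral// iter_env_stepB.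
Qed.

End quenched.
End env_chain.

Section grid_limit.
Variables (d : nat) (R : realType) (dW : measure_display) (W : measurableType dW).
Variables (Y : nat -> W -> Zd d) (S : nat -> W -> R).
Hypothesis S_gt0 : forall n w, 0 < S n w.

(** A square, so that its root m + 1 eventually exceeds any fixed number of rounded holding times,
    yet is negligible compared with the mesh. *)
Definition mesh m : R := (m.+1 ^ 2)%:R.

(* The additional [m.+1] steps, negligible in real time, absorb the rounding of
   the holding times. *)
Definition grid_time (t : R) m : nat := (Num.truncn (mesh m * t) + m.+1)%N.

Lemma mesh_gt0 m : 0 < mesh m. Proof. by rewrite ltr0n. Qed.

Lemma jump_time_rounding g n w : 0 < g ->
  g * jump_time S n w <= jump_time (fun i w => (grid_holding S g i w)%:R : R) n w
    <= g * jump_time S n w + n%:R.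
Proof.
move=> g0; have D_ge i : g * S i w <= (grid_holding S g i w)%:R <= g * S i w + 1.
  have c0 : 0 <= Num.ceil (g * S i w) by rewrite ltW// ceil_gt0 mulr_gt0.
  rewrite -[_%:R]/((Posz (grid_holding S g i w))%:~R) /grid_holding gez0_abs//.
  by rewrite ceil_ge/= -lerBlDr ltW// -[1]/(1%:~R) -intrB ceilB1_lt.
rewrite /jump_time mulr_sumr; apply/andP; split.
  by apply: ler_sum => i _; have /andP[] := D_ge i.
rewrite -[X in X%:R](card_ord n) -sumr_const -big_split/=.
by apply: ler_sum => i _; have /andP[] := D_ge i.
Qed.

Lemma grid_walk_eventually w (t : R) : 0 <= t ->
  jump_time S n w @[n --> \oo] --> +oo ->
  \forall m \near \oo, grid_walk Y S (mesh m) (grid_time t m) w = walk Y S t w.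
Proof.
move=> t0 Soo.
have [n /andP[n1 n2]] : exists n, jump_time S n w <= t < jump_time S n.+1 w.
  have ex : exists n, t < jump_time S n w.
    by have /cvgryPgt/(_ t) [n _ /(_ n (leqnn n)) ?] := Soo; exists n.
  case: (ex_minnP ex) => -[|n] tn mn.
    by move: tn; rewrite /jump_time big_ord0 ltNge t0.
  exists n; rewrite tn andbT leNgt; apply/negP => /mn.
  by rewrite ltnn.
have -> : walk Y S t w = Y n w.
  by apply: walkE; [move=> i; exact: ltW|rewrite n1].
have d0 : 0 < jump_time S n.+1 w - t by rewrite subr_gt0.
(* From m >= n on, the added steps absorb the rounding of n holding times; past the other threshold
   their real duration 1 / (m + 1) is less than the time left before the next jump. *)
exists (maxn n (Num.truncn (jump_time S n.+1 w - t)^-1)) => // m /=.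
rewrite geq_max => /andP[nm dm]; apply: walkE => [i|]; first exact: ler0n.
have M0 : 0 < m.+1%:R :> R by rewrite ltr0n.
have dm' : (jump_time S n.+1 w - t)^-1 < m.+1%:R.
  by rewrite -truncn_lt_nat ?invr_ge0 ?ltW// ltnS.
have dM : 1 < m.+1%:R * (jump_time S n.+1 w - t).
  by rewrite -ltr_pdivrMr// mul1r.
have gE : mesh m = m.+1%:R * m.+1%:R by rewrite /mesh -natrM mulnn.
have gt0 : 0 <= mesh m * t by rewrite mulr_ge0// ltW// mesh_gt0.
have /andP[tr1 tr2] := truncn_itv gt0.
have /andP[_ r2] := jump_time_rounding n w (mesh_gt0 m).
have /andP[r1 _] := jump_time_rounding n.+1 w (mesh_gt0 m).
have nm' : n.+1%:R <= m.+1%:R :> R by rewrite ler_nat ltnS.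
have s1 : mesh m * jump_time S n w <= mesh m * t by rewrite ler_pM2l// mesh_gt0.
rewrite /grid_time natrD; apply/andP; split.
  apply: (le_trans r2); rewrite -addn1 natrD in tr2.
  by move: nm'; rewrite -[n.+1]addn1 natrD; lra.
apply: lt_le_trans r1.
have : m.+1%:R * 1 < m.+1%:R * (m.+1%:R * (jump_time S n.+1 w - t)) by rewrite ltr_pM2l.
rewrite gE !mulrA mulr1 mulrBr -gE; lra.
Qed.

End grid_limit.

(** * Truncation and passage to the limit *)

Section cutoff.
Variables (d : nat) (R : realType).
Implicit Types (f : Omega d R -> R) (omega : Omega d R) (M : nat).

Definition cutoff M f omega : R :=
  if (`|f omega| <= M%:R) && (exit_rate omega 0 <= M%:R) then f omega else 0.

Lemma measurable_cutoff M f : measurable_fun setT f -> measurable_fun setT (cutoff M f).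
Proof.
move=> mf; apply: measurable_fun_ifT => //.
apply: measurable_and; apply: measurable_fun_ler => //.
  exact: measurableT_comp.
exact: measurable_exit_rate.
Qed.

Lemma cutoff_norm_le M f omega : `|cutoff M f omega| <= `|f omega|.
Proof. by rewrite /cutoff; case: ifP => // _; rewrite normr0. Qed.

Lemma cutoff_bounded M f omega : `|cutoff M f omega| <= M%:R.
Proof. by rewrite /cutoff; case: ifP => [/andP[]//|_]; rewrite normr0. Qed.

Lemma cutoff_rate M f omega : cutoff M f omega != 0 -> exit_rate omega 0 <= M%:R.
Proof. by rewrite /cutoff; case: ifP => [/andP[]//|_]; rewrite eqxx. Qed.

Lemma cutoff_norm_ge0 M f omega : 0 <= cutoff M (Num.norm \o f) omega.
Proof. by rewrite /cutoff; case: ifP => // _; exact: normr_ge0. Qed.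

Lemma cutoff_norm_nd f omega : nondecreasing_seq (fun M => cutoff M (Num.norm \o f) omega).
Proof.
move=> M M' MM'; rewrite /cutoff /=; case: ifPn => [/andP[h1 h2]|_].
  have MR : M%:R <= M'%:R :> R by rewrite ler_nat.
  by rewrite (le_trans h1 MR) (le_trans h2 MR).
by case: ifP => // _; exact: normr_ge0.
Qed.

Lemma cutoff_near f omega : \forall M \near \oo, cutoff M f omega = f omega.
Proof.
exists (maxn (Num.truncn `|f omega|).+1 (Num.truncn (exit_rate omega 0)).+1) => // M /=.
rewrite geq_max => /andP[M1 M2]; rewrite /cutoff.
have t1 : `|f omega| <= M%:R.
  by rewrite (le_trans (ltW (truncnS_gt _)))// ler_nat.
have t2 : exit_rate omega 0 <= M%:R.
  by rewrite (le_trans (ltW (truncnS_gt _)))// ler_nat.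
by rewrite t1 t2.
Qed.

End cutoff.

Section semigroup_limit.
Variables (d : nat) (R : realType) (dW : measure_display) (W : measurableType dW).
Hypothesis d_gt0 : (0 < d)%N.
Variable Q : Omega d R -> Zd d -> probability W R.
Variables (Y : nat -> W -> Zd d) (S : nat -> W -> R).
Hypothesis Q_walk : jump_chain_holding_times Q Y S.
Variable omega : Omega d R.
Hypothesis omega_good : no_explosion Q S omega 0.
Variable t : R.
Hypothesis t_ge0 : 0 <= t.
Notation mu := (Q omega 0).
Implicit Types (f : Omega d R -> R) (M m : nat).

Definition grid_semigroup f M m : Omega d R -> R :=
  iter (grid_time t m) (env_step (mesh R m)) (cutoff M f).

Let S_gt0 n w : 0 < S n w. Proof. exact: holding_gt0 Q_walk n w. Qed.

Lemma measurable_walk_fun f : measurable_fun setT (fun w => f (theta (walk Y S t w) omega)).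
Proof.
apply: (@measurable_fibers _ _ _ _ _ (walk Y S t) (fun z => f (theta z omega))).
move=> z; apply: measurable_walk => [n y|n|n w].
- exact: jump_chain_measurable Q_walk n y.
- exact: holding_measurable Q_walk n.
- exact: ltW.
Qed.

Lemma cvg_grid_semigroup f M : measurable_fun setT f ->
  (grid_semigroup f M m omega)%:E @[m --> \oo] -->
    (\int[mu]_w (cutoff M f (theta (walk Y S t w) omega))%:E)%E.
Proof.
move=> mf.
pose f_ m w := (cutoff M f (theta (grid_walk Y S (mesh R m) (grid_time t m) w) omega))%:E.
rewrite (_ : (fun m => _) = fun m => (\int[mu]_w f_ m w)%E); last first.
  by apply/funext => m; rewrite /f_ (grid_integral d_gt0 (mesh_gt0 R m) Q_walk).
apply: (and3_rec (fun _ _ => id) (@dominated_convergence _ _ _ mu _ measurableT f_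
  (fun w => (cutoff M f (theta (walk Y S t w) omega))%:E) (EFin \o cst M%:R) _ _ _ _ _)).
- move=> m; apply/measurable_EFinP/measurable_grid_fun; [exact: mesh_gt0|exact: Q_walk].
- exact/measurable_EFinP/measurable_walk_fun.
- apply: filterS omega_good => w w_good _; apply: cvg_near_cst.
  have ev : \forall m \near \oo,
      grid_walk Y S (mesh R m) (grid_time t m) w = walk Y S t w.
    exact: grid_walk_eventually.
  by apply: filterS ev => m; rewrite /f_ => ->.
- exact: finite_measure_integrable_cst.
- by apply/aeW => w m _; rewrite /f_ /= lee_fin cutoff_bounded.
Qed.

Lemma cvg_cutoff_norm f : measurable_fun setT f ->
  (\int[mu]_w (cutoff M (Num.norm \o f) (theta (walk Y S t w) omega))%:E)%E @[M --> \oo] -->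
    (\int[mu]_w `|(f (theta (walk Y S t w) omega))%:E|)%E.
Proof.
move=> mf; pose g' M w := (cutoff M (Num.norm \o f) (theta (walk Y S t w) omega))%:E.
have lim w : limn (g'^~ w) = `|(f (theta (walk Y S t w) omega))%:E|%E.
  apply/cvg_lim => //; apply: cvg_near_cst.
  by apply: filterS (cutoff_near (Num.norm \o f) (theta (walk Y S t w) omega)) => M; rewrite /g' => ->.
under eq_integral do rewrite -lim.
apply: cvg_monotone_convergence => //.
- by move=> M; exact/measurable_EFinP/measurable_walk_fun.
- by move=> M w _; rewrite lee_fin cutoff_norm_ge0.
- by move=> w _ M M' MM'; rewrite lee_fin cutoff_norm_nd.
Qed.

Lemma cvg_cutoff f : measurable_fun setT f ->
  (\int[mu]_w `|(f (theta (walk Y S t w) omega))%:E| < +oo)%E ->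
  (\int[mu]_w (cutoff M f (theta (walk Y S t w) omega))%:E)%E @[M --> \oo] -->
    semigroup Q Y S f t omega.
Proof.
move=> mf fint.
apply: (and3_rec (fun _ _ => id) (@dominated_convergence _ _ _ mu _ measurableT
  (fun M w => (cutoff M f (theta (walk Y S t w) omega))%:E)
  (fun w => (f (theta (walk Y S t w) omega))%:E)
  (fun w => `|(f (theta (walk Y S t w) omega))%:E|)%E _ _ _ _ _)).
- by move=> M; exact/measurable_EFinP/measurable_walk_fun.
- exact/measurable_EFinP/measurable_walk_fun.
- apply/aeW => w _; apply: cvg_near_cst.
  by apply: filterS (cutoff_near f (theta (walk Y S t w) omega)) => M ->.
- apply: integrable_abse; apply/integrableP; split=> //.
  exact/measurable_EFinP/measurable_walk_fun.
- by apply/aeW => w M _; rewrite /= lee_fin cutoff_norm_le.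
Qed.

(** By monotone convergence the limit assumed finite is the quenched mean of |f(omega(t))|. This
    gives a dominating function for the cut-offs of the signed [f], whose means then converge to
    f_t. *)
Lemma semigroup_sqr_le f : measurable_fun setT f ->
  (limn_einf (fun M => limn_einf (fun m =>
     (grid_semigroup (Num.norm \o f) M m omega)%:E)) < +oo)%E ->
  (semigroup Q Y S f t omega ^+ 2 <=
   limn_einf (fun M => limn_einf (fun m => (grid_semigroup f M m omega ^+ 2)%:E)))%E.
Proof.
move=> mf; have mnf : measurable_fun setT (Num.norm \o f) by exact: measurableT_comp.
rewrite (_ : (fun M => _) = fun M =>
    (\int[mu]_w (cutoff M (Num.norm \o f) (theta (walk Y S t w) omega))%:E)%E); last first.
  apply/funext => M.
  by have [-> _] := cvg_limn_einf_sup (cvg_grid_semigroup (f := Num.norm \o f) (M := M) mnf).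
have [-> _] := cvg_limn_einf_sup (cvg_cutoff_norm mf).
move=> fint; have cf := cvg_cutoff mf fint.
have s_fin : semigroup Q Y S f t omega \is a fin_num.
  by rewrite /semigroup -integral_fin_num_abs//; exact: measurable_walk_fun.
have c_fin M : (\int[mu]_w (cutoff M f (theta (walk Y S t w) omega))%:E)%E \is a fin_num.
  rewrite -integral_fin_num_abs//; last exact: measurable_walk_fun.
  apply: le_lt_trans fint; apply: ge0_le_integral => //.
  - by apply: measurableT_comp => //; exact/measurable_EFinP/measurable_walk_fun.
  - by apply: measurableT_comp => //; exact/measurable_EFinP/measurable_walk_fun.
  - by move=> w _; rewrite lee_fin cutoff_norm_le.
pose al M := fine (\int[mu]_w (cutoff M f (theta (walk Y S t w) omega))%:E)%E.
have inner M : limn_einf (fun m => (grid_semigroup f M m omega ^+ 2)%:E) = (al M ^+ 2)%:E.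
  apply: (cvg_limn_einf_sup _).1; apply: cvg_EFin; first exact: nearW.
  have := cvg_grid_semigroup (f := f) (M := M) mf; rewrite -(fineK (c_fin M)) => /fine_cvg c.
  by apply: cvgM.
rewrite (_ : (fun M => _) = fun M => (al M ^+ 2)%:E); last exact/funext.
have -> : limn_einf (fun M => (al M ^+ 2)%:E) = ((fine (semigroup Q Y S f t omega)) ^+ 2)%:E.
  apply: (cvg_limn_einf_sup _).1; apply: cvg_EFin; first exact: nearW.
  have : al M @[M --> \oo] --> fine (semigroup Q Y S f t omega).
    by apply: fine_cvg; rewrite fineK.
  by move=> c; apply: cvgM.
by rewrite EFin_expe fineK.
Qed.

End semigroup_limit.

Lemma cvg_invmesh (R : realType) (c : R) : c / mesh R m @[m --> \oo] --> 0.
Proof.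
have h := @cvg_harmonic R; rewrite -(mulr0 c) -(mulr0 0).
apply: cvgMr; rewrite (_ : (fun m => _) = (harmonic \* harmonic)); last first.
  by apply/funext => m /=; rewrite /mesh natrX expr2 invfM.
exact: cvgM.
Qed.

Lemma limn_einf_le_cvg (R : realType) (x y : R^nat) (c : R) :
  (forall m, x m <= y m) -> y @ \oo --> c ->
  (limn_einf (fun m => (x m)%:E) <= c%:E)%E.
Proof.
move=> xy yc; have yc' : (y m)%:E @[m --> \oo] --> c%:E.
  by apply: cvg_EFin => //; exact: nearW.
rewrite -(cvg_limn_einf_sup yc').1; apply: le_limn_einf => m.
by rewrite lee_fin.
Qed.

Lemma limn_einf_le_cst (R : realType) (u : (\bar R)^nat) (c : \bar R) :
  (forall m, u m <= c)%E -> (limn_einf u <= c)%E.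
Proof. by move=> /le_limn_einf/le_trans; apply; rewrite (cvg_limn_einf_sup (cvg_cst _)).1. Qed.

(** * Energies of the rounded chain *)

Section energy.
Variables (d : nat) (R : realType) (P : probability (Omega d R) R).
Hypothesis d_gt0 : (0 < d)%N.
Hypothesis P_invariant : forall (x : Zd d) (A : set (Omega d R)),
  measurable A -> P (theta x @^-1` A) = P A.
Implicit Types (M m j : nat).

Notation B m := (Bop d_gt0 P_invariant (mesh_gt0 R m)).
Let ipP := @ip_semi_inner_product _ _ _ P.

Section any_square_integrable.
Variable f : Omega d R -> R.
Hypothesis fL : f \in Lfun P 2%:E.

Let mf : measurable_fun setT f. Proof. exact: Lfun2_measurable fL. Qed.

Lemma cutoff_Lfun2 M : cutoff M f \in Lfun P 2%:E.
Proof.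
apply: (Lfun2_dominated (measurable_cutoff M mf) fL (C := 1)) => o.
by rewrite mul1r cutoff_norm_le.
Qed.

Lemma hat_Lfun2 M m :
  (fun omega => cutoff M f omega / phi (mesh R m) omega) \in Lfun P 2%:E.
Proof.
apply: (Lfun2_dominated _ fL (C := 1 + M%:R / mesh R m)) => [|w].
  apply: measurable_funM; first exact: measurable_cutoff.
  by apply: measurable_funV => [|w]; [exact: measurable_phi (mesh_gt0 R m)|exact: phi_gt0 (mesh_gt0 R m) _].
rewrite normrM mulrC.
have [->|c0] := eqVneq (cutoff M f w) 0.
  by rewrite normr0 mulr0 mulr_ge0// addr_ge0// divr_ge0// ltW// mesh_gt0.
apply: ler_pM => //; last exact: cutoff_norm_le.
have p0 := phi_gt0 d_gt0 (mesh_gt0 R m) w.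
rewrite ger0_norm ?invr_ge0 ?(ltW p0)//.
have : (phi (mesh R m) w)^-1 <= (phi2 (mesh R m) w)^-1.
  rewrite -(phi_sqr d_gt0 (mesh_gt0 R m)) lef_pV2 ?posrE ?exprn_gt0// expr2.
  by rewrite ler_piMl ?(ltW p0)// (le_trans (ler_norm _))// phi_le1// mesh_gt0.
move=> /le_trans; apply.
rewrite (le_trans (invphi2_le d_gt0 (mesh_gt0 R m) w))// lerD2l.
by rewrite ler_pM2r ?invr_gt0 ?mesh_gt0//; exact: cutoff_rate c0.
Qed.

Definition hat M m : L2 P := toL2 (hat_Lfun2 M m).

Lemma hatE M m omega : phi (mesh R m) omega * hat M m omega = cutoff M f omega.
Proof. by rewrite mulrC divfK// gt_eqF// phi_gt0// mesh_gt0. Qed.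

Definition energy M m j : R := ip (iter j (B m) (hat M m)) (iter j (B m) (hat M m)).

Lemma energy_ge0 M m j : 0 <= energy M m j. Proof. exact: sdot_ge0. Qed.

Lemma energy_le M m i j : (i <= j)%N -> energy M m j <= energy M m i.
Proof.
apply: norm_iter_le => //.
- exact: BopD.
- exact: BopZ.
- exact: Bop_sym.
- exact: Bop_ge.
- exact: Bop_le.
Qed.

Let fL2 : L2 P := toL2 fL.

Lemma energy_le_norm M m j : energy M m j <= (1 + M%:R / mesh R m) * ip fL2 fL2.
Proof.
apply: (le_trans (energy_le M m (leq0n j))).
apply: (hh_norm_le d_gt0 (mesh_gt0 R m) (h := toL2 (cutoff_Lfun2 M))) => [|o|o|o].
- exact: ler0n.
- exact: cutoff_norm_le.
- exact: cutoff_rate.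
- exact: hatE.
Qed.

Lemma measurable_grid_semigroup t M m : measurable_fun setT (grid_semigroup t f M m).
Proof. exact: measurable_iter_env_step (measurable_cutoff M mf). Qed.

(** Iterating the chain on the cut-off gives phi times an iterate of [B], and phi <= 1. As energies
    are nonincreasing, the extra steps in [grid_time] cost nothing. *)
Lemma integral_grid_semigroup_le t M m j : (j <= grid_time t m)%N ->
  (\int[P]_omega (grid_semigroup t f M m omega ^+ 2)%:E <= (energy M m j)%:E)%E.
Proof.
move=> jk; apply: (@le_trans _ _ (energy M m (grid_time t m))%:E); last first.
  by rewrite lee_fin; exact: energy_le.
rewrite ip_sqrE; apply: ge0_le_integral => //.
- by move=> o _; rewrite lee_fin sqr_ge0.
- by apply/measurable_EFinP; apply: measurable_funX; exact: measurable_grid_semigroup.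
- by apply/measurable_EFinP; apply: measurable_funX; exact: L2_measurable.
- move=> o _; rewrite lee_fin /grid_semigroup.
  rewrite (iter_env_step_phi d_gt0 (mesh_gt0 R m) P_invariant _ (hatE M m)).
  rewrite exprMn ler_piMl ?sqr_ge0// -[leLHS]real_normK ?num_real// expr_le1//.
  by apply: phi_le1 => //; exact: mesh_gt0.
Qed.

Lemma fatou2 (F : nat -> nat -> Omega d R -> R) (b : nat -> nat -> R) :
  (forall M m, measurable_fun setT (F M m)) ->
  (forall M m omega, 0 <= F M m omega) ->
  (forall M m, \int[P]_omega (F M m omega)%:E <= (b M m)%:E)%E ->
  (\int[P]_omega limn_einf (fun M => limn_einf (fun m => (F M m omega)%:E)) <=
   limn_einf (fun M => limn_einf (fun m => (b M m)%:E)))%E.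
Proof.
move=> mF F0 Fb; apply: le_trans.
  apply: fatou => // [M|M o _].
    by apply: measurable_limn_einf => m; exact/measurable_EFinP.
  by apply: limn_einf_ge0 => m; rewrite lee_fin.
apply: le_limn_einf => M; apply: le_trans; last first.
  by apply: le_limn_einf => m; exact: Fb.
apply: fatou => // [m|m o _]; first exact/measurable_EFinP.
by rewrite lee_fin.
Qed.

Lemma grid_semigroup_lty t : {ae P, forall omega,
  (limn_einf (fun M => limn_einf (fun m => (grid_semigroup t f M m omega)%:E)) < +oo)%E}.
Proof.
(* s <= s^2 + 1 passes from the squares, bounded by energies, to the values themselves. *)
pose F M m omega := grid_semigroup t f M m omega ^+ 2 + 1.
have mF M m : measurable_fun setT (F M m).
  by apply: measurable_funD => //; apply: measurable_funX; exact: measurable_grid_semigroup.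
have F0 M m omega : 0 <= F M m omega by rewrite addr_ge0// sqr_ge0.
have Fb M m : (\int[P]_omega (F M m omega)%:E <= (energy M m 0 + 1)%:E)%E.
  under eq_integral do rewrite EFinD.
  rewrite ge0_integralD//; last 2 first.
  - by move=> o _; rewrite lee_fin sqr_ge0.
  - by apply/measurable_EFinP; apply: measurable_funX; exact: measurable_grid_semigroup.
  rewrite EFinD; apply: leeD; first exact: integral_grid_semigroup_le.
  by rewrite integral_cst_probability// mul1e probability_setT.
have Foo := fatou2 mF F0 Fb.
pose U omega := limn_einf (fun M => limn_einf (fun m => (F M m omega)%:E)).
have U0 omega : (0 <= U omega)%E.
  by apply: limn_einf_ge0 => M; apply: limn_einf_ge0 => m; rewrite lee_fin.
have mU : measurable_fun setT U.
  apply: measurable_limn_einf => M; apply: measurable_limn_einf => m.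
  exact/measurable_EFinP.
have iU : P.-integrable setT U.
  apply/integrableP; split=> //; under eq_integral do rewrite gee0_abs//.
  apply: (le_lt_trans Foo).
  apply: (@le_lt_trans _ _ (ip fL2 fL2 + 1)%:E); last exact: ltry.
  have inner M : (limn_einf (fun m => (energy M m 0 + 1)%:E) <= (ip fL2 fL2 + 1)%:E)%E.
    apply: limn_einf_le_cvg (fun m => (1 + M%:R / mesh R m) * ip fL2 fL2 + 1) _ _ _ => [m|].
      by rewrite lerD2r energy_le_norm.
    have : (1 + M%:R / mesh R m) * ip fL2 fL2 + 1 @[m --> \oo] -->
        (1 + 0) * ip fL2 fL2 + 1.
      apply: cvgD; last exact: cvg_cst.
      by apply: cvgMl; apply: cvgD; [exact: cvg_cst|exact: cvg_invmesh].
    by rewrite addr0 mul1r.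
  exact: limn_einf_le_cst.
have := integrable_ae measurableT iU.
apply: filterS => o /(_ Logic.I) Ufin; apply: (@le_lt_trans _ _ (U o)).
  apply: le_limn_einf => M; apply: le_limn_einf => m; rewrite lee_fin /F.
  by have := sqr_ge0 (grid_semigroup t f M m o - 1); nra.
by rewrite -ge0_fin_numE.
Qed.

End any_square_integrable.
End energy.

(** * Decay of the limiting energy *)

Section decay.
Variables (d : nat) (R : realType) (P : probability (Omega d R) R).
Hypothesis d_gt0 : (0 < d)%N.
Hypothesis P_invariant : forall (x : Zd d) (A : set (Omega d R)),
  measurable A -> P (theta x @^-1` A) = P A.
Hypothesis P_ge1 : forall e : edge d,
  {ae P, forall omega : Omega d R, 1 <= weight omega e}.
Variable f : Omega d R -> R.
Hypothesis mf : measurable_fun setT f.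
Hypothesis Nf : (Nnorm P f < +oo)%E.
Implicit Types (M m j K : nat).

Let fL : f \in Lfun P 2%:E. Proof. exact: Nnorm_Lfun2. Qed.
Let fL2 : L2 P := toL2 fL.
Let N := fine (Nnorm P f).
Let ipP := @ip_semi_inner_product _ _ _ P.
Notation energy := (energy d_gt0 P_invariant fL).

Let N_ge0 : 0 <= N. Proof. by rewrite fine_ge0// Nnorm_ge0. Qed.

(** A majorant of the second moment of f_t that is measurable in t, on which the time integral is
    estimated. *)
Definition energy_limit (t : R) : \bar R := limn_einf (fun M => limn_einf
  (fun m => (energy M m (Num.truncn (mesh R m * t)))%:E)).

Section walk.
Variables (dW : measure_display) (W : measurableType dW).
Variable Q : Omega d R -> Zd d -> probability W R.
Variables (Y : nat -> W -> Zd d) (S : nat -> W -> R).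
Hypothesis Q_walk : jump_chain_holding_times Q Y S.
Hypothesis Q_no_explosion : {ae P, forall omega : Omega d R,
      forall x : Zd d, no_explosion Q S omega x}.

Lemma semigroup_le_energy_limit (t : R) : 0 <= t ->
  (\int[P]_omega (semigroup Q Y S f t omega ^+ 2) <= energy_limit t)%E.
Proof.
move=> t0.
have sqr_m M m : measurable_fun setT (fun o => grid_semigroup t f M m o ^+ 2).
  by apply: measurable_funX; exact: (measurable_grid_semigroup d_gt0 fL).
apply: (@le_trans _ _ (\int[P]_omega limn_einf (fun M => limn_einf (fun m =>
    (grid_semigroup t f M m omega ^+ 2)%:E)))%E); last first.
  apply: (fatou2 (F := fun M m o => grid_semigroup t f M m o ^+ 2)) => // [M m o|M m].
    exact: sqr_ge0.
  by apply: integral_grid_semigroup_le; exact: leq_addr.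
apply: ge0_outer_le_integral => //.
- apply: measurable_limn_einf => M; apply: measurable_limn_einf => m.
  exact/measurable_EFinP.
- by move=> o _; exact: sqre_ge0.
- move=> o _; apply: limn_einf_ge0 => M; apply: limn_einf_ge0 => m.
  by rewrite lee_fin sqr_ge0.
have nfL : Num.norm \o f \in Lfun P 2%:E.
  apply: (@Lfun2_dominated _ _ _ _ _ f 1); [exact: measurableT_comp|exact: fL|].
  by move=> o; rewrite /= normr_id mul1r.
have lty := grid_semigroup_lty d_gt0 P_invariant nfL t.
apply: filterS2 Q_no_explosion lty => o o_good o_lty _.
exact: (semigroup_sqr_le d_gt0 Q_walk (o_good 0) t0 mf o_lty).
Qed.

End walk.

Definition cutoff_dist M : R :=
  ip (toL2 (cutoff_Lfun2 fL M) - fL2) (toL2 (cutoff_Lfun2 fL M) - fL2).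

Lemma cvg_cutoff_dist : cutoff_dist M @[M --> \oo] --> 0.
Proof.
have : (cutoff_dist M)%:E @[M --> \oo] --> (\int[P]_omega (cst 0 omega))%E.
  rewrite (_ : (fun M => _) = fun M => (\int[P]_o ((cutoff M f o - f o) ^+ 2)%:E)%E); last first.
    by apply/funext => M; rewrite ip_sqrE.
  apply: (and3_rec (fun _ _ => id) (@dominated_convergence _ _ _ P _ measurableT
    (fun M o => ((cutoff M f o - f o) ^+ 2)%:E) (cst 0%E)
    (fun o => (f o ^+ 2)%:E) _ _ _ _ _)).
  - move=> M; apply/measurable_EFinP; apply: measurable_funX.
    by apply: measurable_funB => //; exact: measurable_cutoff.
  - exact: measurable_cst.
  - apply/aeW => o _; apply: cvg_near_cst.
    by apply: filterS (cutoff_near f o) => M ->; rewrite subrr expr0n.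
  - exact: Lfun2_integrable_sqr.
  - apply/aeW => o M _; rewrite /= lee_fin ger0_norm ?sqr_ge0// /cutoff.
    by case: ifP => _; rewrite ?subrr ?expr0n ?sqr_ge0// sub0r sqrrN.
by rewrite integral0 => /fine_cvg.
Qed.

Let err M m : R := 16 * (cutoff_dist M + (M%:R / mesh R m) ^+ 2 * ip fL2 fL2)
  + 2 * (M%:R / mesh R m) * ip fL2 fL2.

Let err_ge0 M m : 0 <= err M m.
Proof.
have f0 : 0 <= ip fL2 fL2 by exact: sdot_ge0.
have g0 : 0 <= M%:R / mesh R m by rewrite divr_ge0// ltW// mesh_gt0.
have c0 : 0 <= cutoff_dist M by exact: sdot_ge0.
apply: addr_ge0; last by apply: mulr_ge0 => //; exact: mulr_ge0.
by rewrite mulr_ge0// addr_ge0// mulr_ge0// exprn_ge0.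
Qed.

Let cvg_err M : err M m @[m --> \oo] --> 16 * cutoff_dist M.
Proof.
have c := @cvg_invmesh R M%:R.
have : err M m @[m --> \oo] --> 16 * (cutoff_dist M + 0 ^+ 2 * ip fL2 fL2) + 2 * 0 * ip fL2 fL2.
  apply: cvgD; last by apply: cvgMl; exact: cvgMr.
  apply: cvgMr; apply: cvgD; first exact: cvg_cst.
  by apply: cvgMl; rewrite expr2; apply: cvgM.
by rewrite mulr0 !mul0r expr0n mul0r !addr0.
Qed.

Let cvg_err2 : 16 * cutoff_dist M @[M --> \oo] --> 0.
Proof. by rewrite -(mulr0 16); apply: cvgMr; exact: cvg_cutoff_dist. Qed.

(** 64 is the 4 of the weight [4 * g] in the occupation estimate, with the mesh factored out, times
    the 16 of the Poincare constants. *)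
Definition diffusive K : R := 64 * d%:R ^+ 2 * scale_sum d R K * N.

Lemma sum_energy_le K M m n : (0 < n)%N ->
  \sum_(j < n) energy M m j <= mesh R m * diffusive K +
    n%:R * (8 * (N / 2 ^+ (K * d)) + err M m).
Proof.
move=> n0.
have := occupation_le d_gt0 P_invariant P_ge1 (mesh_gt0 R m) (f := fL2)
  (h := toL2 (cutoff_Lfun2 fL M)) (hh := hat d_gt0 fL M m) (M := M%:R) (ler0n _ _)
  Nf (cutoff_norm_le M f) (@cutoff_rate _ _ M f) (hatE d_gt0 fL M m) K n0.
move=> /le_trans; apply; rewrite /diffusive /err /cutoff_dist -/N.
rewrite le_eqVlt; apply/orP; left; apply/eqP; ring.
Qed.

(** The last of n + 1 nonincreasing energies is at most their mean, and n + 1 >= mesh t bounds mesh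
    / (n + 1) by 1 / t. *)
Lemma energy_point_le K M m (t : R) : 0 < t ->
  energy M m (Num.truncn (mesh R m * t)) <=
    diffusive K / t + 8 * (N / 2 ^+ (K * d)) + err M m.
Proof.
move=> t0; set n := Num.truncn _.
have n1 : 0 < n.+1%:R :> R by rewrite ltr0n.
have g0 := mesh_gt0 R m.
have nt : mesh R m * t <= n.+1%:R by rewrite ltW// truncnS_gt.
have s0 : 0 <= diffusive K.
  rewrite mulr_ge0// mulr_ge0 ?mulr_ge0 ?exprn_ge0//.
  by apply: sumr_ge0 => k _; rewrite divr_ge0 ?exprn_ge0.
rewrite -(ler_pM2l n1).
apply: (@le_trans _ _ (\sum_(j < n.+1) energy M m j)).
  rewrite -[X in X%:R * _](card_ord n.+1) -sumr_const mulr_suml.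
  by apply: ler_sum => j _; rewrite mul1r energy_le// -ltnS.
apply: (le_trans (sum_energy_le K M m (ltn0Sn n))).
rewrite -[X in _ <= _ * X]addrA [leRHS]mulrDr lerD2r [leRHS]mulrA ler_pdivlMr//.
by rewrite mulrAC; apply: ler_wpM2r.
Qed.

Lemma energy_limit_le K (t : R) : 0 < t ->
  (energy_limit t <= (diffusive K / t + 8 * (N / 2 ^+ (K * d)))%:E)%E.
Proof.
move=> t0.
apply: (@le_trans _ _ (limn_einf (fun M =>
    (diffusive K / t + 8 * (N / 2 ^+ (K * d)) + 16 * cutoff_dist M)%:E))).
  apply: le_limn_einf => M; apply: limn_einf_le_cvg => [m|].
    exact: energy_point_le K M m t t0.
  by apply: cvgD; [exact: cvg_cst|exact: cvg_err].
apply: (limn_einf_le_cvg (fun M => lexx _)).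
by rewrite -[X in _ --> X]addr0; apply: cvgD; [exact: cvg_cst|exact: cvg_err2].
Qed.

Local Notation leb := (@lebesgue_measure R).

Lemma measurable_truncn_mesh m (a : nat -> R) :
  measurable_fun setT (fun t : R => a (Num.truncn (mesh R m * t))).
Proof.
apply: (@measurable_fibers _ _ _ _ _ (fun t : R => Num.truncn (mesh R m * t)) a) => j.
have ge k : measurable [set t : R | (k < Num.truncn (mesh R m * t))%N].
  rewrite (_ : [set t | _] = `[k.+1%:R / mesh R m, +oo[%classic) //.
  apply/seteqP; split=> t /=; rewrite in_itv/= andbT.
    rewrite truncn_gt_nat ler_pdivrMr ?mesh_gt0// mulrC//.
  by rewrite truncn_gt_nat ler_pdivrMr ?mesh_gt0// mulrC.
case: j => [|j].
  rewrite (_ : _ @^-1` _ = ~` [set t : R | (0 < Num.truncn (mesh R m * t))%N]).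
    exact: measurableC.
  by apply/seteqP; split=> t /=; [move=> ->|move=> /negP; rewrite lt0n negbK => /eqP].
rewrite (_ : _ @^-1` _ = [set t : R | (j < Num.truncn (mesh R m * t))%N] `\`
   [set t : R | (j.+1 < Num.truncn (mesh R m * t))%N]); first exact: measurableD.
by apply/seteqP; split=> t /=; [move=> ->; split; lia|move=> [? ?]; lia].
Qed.

(** In real time the energy is a step function with steps of length 1 / mesh, so the sum of the
    energies is divided by the mesh. The extra 1 / mesh beside tau pays for the last, possibly
    incomplete step. *)
Lemma integral_energy_le K M m (tau : R) : 0 < tau ->
  (\int[leb]_(t in `[0%R, tau]) (energy M m (Num.truncn (mesh R m * t)))%:E <=
   (diffusive K + (tau + 1 / mesh R m) * (8 * (N / 2 ^+ (K * d)) + err M m))%:E)%E.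
Proof.
move=> tau0; have g0 := mesh_gt0 R m; set g := mesh R m in g0 *.
pose n := (Num.truncn (g * tau)).+1.
pose I j := `[(j%:R / g)%R, (j.+1%:R / g)%R[%classic : set R.
have mI j : measurable (I j) by exact: measurable_itv.
have mindic j : measurable_fun setT (fun t => (\1_(I j) t : R)%:E).
  by apply/measurable_EFinP; apply: measurable_indic; exact: mI.
have mEI j : measurable_fun setT (fun t => (energy M m j * \1_(I j) t)%:E).
  by apply/measurable_EFinP; apply: measurable_funM => //; exact: measurable_indic.
apply: (@le_trans _ _ (\int[leb]_t (\sum_(j < n) (energy M m j * \1_(I j) t)%:E))%E).
  rewrite integral_mkcond; apply: ge0_le_integral => //.
  - by move=> t _; apply: erestrict_ge0 => s _; rewrite lee_fin energy_ge0.
  - apply/(measurable_restrictT _ (measurable_itv _)); apply: measurable_funTS.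
    by apply/measurable_EFinP; exact: measurable_truncn_mesh.
  - by apply: emeasurable_sum => j; exact: mEI.
  move=> t _; rewrite patchE; case: ifPn => [/set_mem|_]; last first.
    by apply: sume_ge0 => j _; rewrite lee_fin mulr_ge0 ?energy_ge0.
  rewrite /= in_itv/= => /andP[t0 t1].
  have gt : 0 <= g * t by rewrite mulr_ge0// ltW.
  have jn : (Num.truncn (g * t) < n)%N.
    by rewrite ltnS; apply: le_truncn; rewrite ler_pM2l.
  rewrite sumEFin lee_fin (bigD1 (Ordinal jn))//=.
  rewrite indicE mem_set ?mulr1 ?lerDl ?sumr_ge0//.
    by move=> j _; rewrite mulr_ge0 ?energy_ge0.
  have /andP[h1 h2] := truncn_itv gt.
  by rewrite /I /= in_itv/= ler_pdivrMr// ltr_pdivlMr// ![t * g]mulrC h1 h2.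
rewrite ge0_integral_sum//; last 2 first.
- by move=> j; exact: mEI.
- by move=> j t _; rewrite lee_fin mulr_ge0 ?energy_ge0.
rewrite (eq_bigr (fun j : 'I_n => (energy M m j / g)%:E)) => [|j _]; last first.
  under eq_integral do rewrite EFinM.
  rewrite ge0_integralZl//; last 2 first.
  - exact: mindic.
  - by rewrite lee_fin energy_ge0.
  rewrite integral_indic//; last exact: mI.
  transitivity ((energy M m j)%:E * leb (I j))%E; first by rewrite setIT.
  rewrite lebesgue_measure_itv/= lte_fin.
  rewrite ltr_pM2r ?invr_gt0// ltr_nat ltnSn -EFinB -EFinM.
  by congr EFin; rewrite -[j.+1]addn1 natrD; field; rewrite gt_eqF.
rewrite sumEFin lee_fin -mulr_suml ler_pdivrMr//.
apply: (le_trans (sum_energy_le K M m (ltn0Sn _))); rewrite -/g -/n.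
rewrite [leRHS]mulrDl [diffusive K * g]mulrC lerD2l mulrAC.
apply: ler_wpM2r.
  by rewrite addr_ge0 ?err_ge0// mulr_ge0 ?divr_ge0 ?exprn_ge0.
rewrite mulrDl div1r mulVf ?gt_eqF// /n -addn1 natrD lerD2r [leRHS]mulrC.
by have /truncn_itv/andP[] : 0 <= g * tau by rewrite mulr_ge0// ltW.
Qed.

Lemma energy_limit_ge0 t : (0 <= energy_limit t)%E.
Proof.
apply: limn_einf_ge0 => M; apply: limn_einf_ge0 => m.
by rewrite lee_fin energy_ge0.
Qed.

Lemma measurable_energy_limit : measurable_fun setT energy_limit.
Proof.
apply: measurable_limn_einf => M; apply: measurable_limn_einf => m.
by apply/measurable_EFinP; exact: (measurable_truncn_mesh m (energy M m)).
Qed.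

Lemma integral_energy_limit_le K (tau : R) : 0 < tau ->
  (\int[leb]_(t in `[0%R, tau]) energy_limit t <=
    (diffusive K + tau * (8 * (N / 2 ^+ (K * d))))%:E)%E.
Proof.
move=> tau0; have men M m : measurable_fun `[0, tau]
    (fun t => (energy M m (Num.truncn (mesh R m * t)))%:E).
  by apply: measurable_funTS; apply/measurable_EFinP; exact: (measurable_truncn_mesh m (energy M m)).
apply: le_trans.
  apply: fatou => // [M|M t _]; first by apply: measurable_limn_einf => m; exact: men.
  by apply: limn_einf_ge0 => m; rewrite lee_fin energy_ge0.
apply: (@le_trans _ _ (limn_einf (fun M =>
    (diffusive K + tau * (8 * (N / 2 ^+ (K * d)) + 16 * cutoff_dist M))%:E))).
  apply: le_limn_einf => M; apply: le_trans.
    apply: fatou => // [m|m t _]; first exact: men.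
    by rewrite lee_fin energy_ge0.
  apply: (@le_trans _ _ (limn_einf (fun m => (diffusive K + (tau + 1 / mesh R m) *
      (8 * (N / 2 ^+ (K * d)) + err M m))%:E))).
    by apply: le_limn_einf => m; exact: integral_energy_le.
  apply: (limn_einf_le_cvg (fun m => lexx _)).
  rewrite -[X in _ + X * (_ + _)]addr0; apply: cvgD; first exact: cvg_cst.
  apply: cvgM; first by apply: cvgD; [exact: cvg_cst|exact: cvg_invmesh].
  by apply: cvgD; [exact: cvg_cst|exact: cvg_err].
apply: (limn_einf_le_cvg (fun M => lexx _)).
rewrite -[X in _ + tau * X]addr0; apply: cvgD; first exact: cvg_cst.
by apply: cvgMr; apply: cvgD; [exact: cvg_cst|exact: cvg_err2].
Qed.

End decay.

(** Fatou for the restrictions of [V] to [0, n + 1], which are eventually constant at each point. *)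
Lemma integral_halfline_le (R : realType) (V : R -> \bar R) (c : \bar R) :
  measurable_fun setT V -> (forall t, 0 <= V t)%E ->
  (forall tau : R, (0 < tau)%R ->
    \int[lebesgue_measure]_(t in `[0%R, tau]) V t <= c)%E ->
  (\int[lebesgue_measure]_(t in [set t : R | (0 <= t)%R]) V t <= c)%E.
Proof.
move=> mV V0 Vc.
pose F (n : nat) := V \_ `[0%R, n.+1%:R].
rewrite integral_mkcond.
have -> : V \_ [set t : R | 0 <= t] = fun t => limn_einf (F ^~ t).
  apply/funext => t; apply/esym; apply: (cvg_limn_einf_sup _).1.
  apply: cvg_near_cst; exists (Num.truncn t) => // n /= tn.
  rewrite /F !patchE; congr (if _ then _ else _).
  apply/idP/idP => /set_mem h; apply/mem_set; rewrite /= ?in_itv/= in h *.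
    by have /andP[] := h.
  by rewrite h (le_trans (ltW (truncnS_gt _)))// ler_nat ltnS.
apply: le_trans.
  apply: fatou => // [n|n t _].
    apply/(measurable_restrictT _ (measurable_itv _)).
    exact: measurable_funTS.
  by apply: erestrict_ge0 => s _.
apply: limn_einf_le_cst => n; rewrite -integral_mkcond.
by apply: Vc; rewrite ltr0n.
Qed.

Lemma exp_bracket (R : realType) (b : nat) (x : R) : (1 < b)%N -> 1 <= x ->
  exists K, b%:R ^+ K <= x < b%:R ^+ K.+1.
Proof.
move=> b1 x1; exists (trunc_log b (Num.truncn x)).
have t0 : (0 < Num.truncn x)%N by rewrite truncn_gt0.
have /andP[l1 l2] := trunc_log_bounds b1 t0.
have /andP[h1 h2] := truncn_itv (le_trans ler01 x1).
rewrite -!natrX; apply/andP; split.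
  by apply: le_trans h1; rewrite ler_nat.
by apply: (lt_le_trans h2); rewrite ler_nat.
Qed.

(** * Sums over scales and the three rates *)

Section scale_sums.
Variable R : realType.

Lemma scale_sum1 K : scale_sum 1 R K <= 2 ^+ K.
Proof.
rewrite /scale_sum; elim: K => [|K IH]; first by rewrite big_ord0.
rewrite big_ord_recr/= muln1 exprS mulr_natl mulr2n lerD//.
by rewrite (_ : 4 = 2 * 2 :> R) ?exprMn ?mulfK ?expf_neq0//; ring.
Qed.

Lemma scale_sum2 K : scale_sum 2 R K = K%:R.
Proof.
rewrite /scale_sum -[RHS]mulr1 -[in RHS](card_ord K) mulr_natl -sumr_const.
apply: eq_bigr => k _; rewrite mulnC exprM (_ : 2 ^+ 2 = 4 :> R); last by ring.
by rewrite divff// expf_neq0.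
Qed.

(** Each term is at most 2^(-k); the induction carries the exact value 2 - 2 * 2^(-K) of the
    geometric sum. *)
Lemma scale_sum3 d K : (3 <= d)%N -> scale_sum d R K <= 2.
Proof.
move=> d3; suff : scale_sum d R K <= 2 - 2 * (2 ^+ K)^-1.
  by move=> /le_trans; apply; rewrite gerBl mulr_ge0 ?invr_ge0 ?exprn_ge0.
rewrite /scale_sum; elim: K => [|K IH]; first by rewrite big_ord0 expr0 invr1 mulr1 subrr.
rewrite big_ord_recr/=.
have p0 : 0 < 2 ^+ K :> R by rewrite exprn_gt0.
have step : 4 ^+ K / 2 ^+ (K * d) <= (2 ^+ K)^-1 :> R.
  rewrite ler_pdivrMr ?exprn_gt0// mulrC ler_pdivlMr//.
  rewrite (_ : 4 = 2 ^+ 2 :> R); last by ring.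
  by rewrite -exprM -exprD ler_weXn2l ?ler1n//; nia.
rewrite exprS invfM; lra.
Qed.

End scale_sums.

Theorem theorem2p2 (R : realType) (d : nat) (d_ge1 : (1 <= d)%N)
    (P : probability (Omega d R) R)
    (P_invariant : forall (x : Zd d) (A : set (Omega d R)),
      measurable A -> P (theta x @^-1` A) = P A)
    (P_ge1 : forall e : edge d,
      {ae P, forall omega : Omega d R, 1 <= weight omega e})
    (dW : measure_display) (W : measurableType dW)
    (Q : Omega d R -> Zd d -> probability W R)
    (Y : nat -> W -> Zd d) (S : nat -> W -> R)
    (Q_walk : jump_chain_holding_times Q Y S)
    (Q_no_explosion : {ae P, forall omega : Omega d R,
      forall x : Zd d, no_explosion Q S omega x}) :
  exists C : R, 0 < C /\
    forall f : Omega d R -> R, measurable_fun [set: Omega d R] f ->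
      (Nnorm P f < +oo)%E ->
      (forall t : R, 0 < t ->
        [/\ d = 1%N ->
              (\int[P]_omega (semigroup Q Y S f t omega ^+ 2)
                 <= C%:E * Nnorm P f * ((Num.sqrt t)^-1)%R%:E)%E,
            d = 2%N ->
              (\int[P]_omega (semigroup Q Y S f t omega ^+ 2)
                 <= C%:E * Nnorm P f * (ln_plus t / t)%R%:E)%E
          & (3 <= d)%N ->
              (\int[P]_omega (semigroup Q Y S f t omega ^+ 2)
                 <= C%:E * Nnorm P f * (t^-1)%R%:E)%E]) /\
      ((3 <= d)%N ->
        (\int[lebesgue_measure]_(t in [set t : R | (0 <= t)%R])
           \int[P]_omega (semigroup Q Y S f t omega ^+ 2)
           <= C%:E * Nnorm P f)%E).
Proof.
have l4 : 0 < ln 4%:R :> R by rewrite ln_gt0// ltr1n.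
have i4 : 0 < (ln 4%:R)^-1 :> R by rewrite invr_gt0.
(* The cases cost 64 + 16 for d = 1, 256 / ln 4 + 32 for d = 2 and 128 d^2 + 8 for d >= 3. *)
pose C : R := 128 * d%:R ^+ 2 + 256 / ln 4%:R + 300.
have C_ge : 300 <= C.
  by rewrite /C lerDr addr_ge0// mulr_ge0 ?exprn_ge0// ltW.
exists C; split=> [|f mf Nf]; first by lra.
pose N := fine (Nnorm P f).
have N0 : 0 <= N by rewrite fine_ge0// Nnorm_ge0.
have NE : Nnorm P f = N%:E by rewrite fineK// ge0_fin_numE// Nnorm_ge0.
have sg t : 0 <= t -> _ :=
  semigroup_le_energy_limit d_ge1 P_invariant mf Nf Q_walk Q_no_explosion (t := t).
have el K t : 0 < t -> _ :=
  energy_limit_le d_ge1 P_invariant P_ge1 mf Nf K (t := t).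
have pt K (t c : R) : 0 < t ->
    diffusive P f K / t + 8 * (N / 2 ^+ (K * d)) <= C * N * c ->
    (\int[P]_omega (semigroup Q Y S f t omega ^+ 2) <= C%:E * Nnorm P f * c%:E)%E.
  move=> t0 h; apply: (le_trans (sg t (ltW t0))); apply: (le_trans (el K t t0)).
  by rewrite NE -!EFinM lee_fin.
(* With no scale at all, K = 0, the bound is 8 N: enough for short times, when the rate is at least
   1. *)
have pt0 (t c : R) : 0 < t -> 1 <= c ->
    (\int[P]_omega (semigroup Q Y S f t omega ^+ 2) <= C%:E * Nnorm P f * c%:E)%E.
  move=> t0 c1; apply: (pt 0%N) => //.
  rewrite /diffusive /scale_sum big_ord0 mulr0 !mul0r add0r mul0n expr0 divr1.
  have : 8 * N <= C * N by rewrite ler_wpM2r//; lra.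
  move=> /le_trans; apply; rewrite ler_peMr// mulr_ge0//; lra.
split=> [t t0|d3].
- split=> [d1|d2|d3].
  + have s0 : 0 < Num.sqrt t by rewrite sqrtr_gt0.
    have [t1|t1] := ltP t 1.
      by apply: pt0 => //; rewrite invf_ge1// -[leRHS]sqrtr1 ler_sqrt// ltW.
    have s1 : 1 <= Num.sqrt t by rewrite -[leLHS]sqrtr1 ler_sqrt// ltW.
    (* The two terms, of orders 2^K / t and 2^(-K), balance when 2^K is of order sqrt t. *)
    have [K /andP[K1 K2]] := exp_bracket (ltnSn 1) s1.
    apply: (pt K) => //; rewrite /diffusive -/N.
    have sK : scale_sum d R K <= 2 ^+ K by rewrite d1 scale_sum1.
    have -> : d%:R = 1 :> R by rewrite d1.
    have -> : (K * d)%N = K by rewrite d1 muln1.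
    rewrite expr1n mulr1.
    move: s0 s1 K1 K2 sK; rewrite -[t in _ / t](sqr_sqrtr (ltW t0)).
    set s := Num.sqrt t; set p : R := 2 ^+ K; move=> s0 s1 K1 K2 sK.
    have p0 : 0 < p by rewrite exprn_gt0.
    have a1 : 64 * scale_sum d R K * N / s ^+ 2 <= 64 * N / s.
      rewrite ler_pdivrMr ?exprn_gt0// expr2 mulrA divfK ?gt_eqF//.
      rewrite mulrAC ler_wpM2l ?mulr_ge0//; lra.
    have a2 : 8 * (N / p) <= 16 * N / s.
      rewrite mulrA ler_pdivrMr// mulrAC ler_pdivlMr//.
      have : N * s <= N * (2 * p) by rewrite ler_wpM2l// ltW// -exprS.
      lra.
    have a3 : 80 * (N / s) <= C * N / s.
      by rewrite -mulrA ler_wpM2r ?divr_ge0 ?(ltW s0)//; lra.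
    lra.
  + have lp : 1 <= ln_plus t by rewrite le_max lexx.
    have [t1|t1] := ltP t 1.
      apply: pt0 => //; rewrite ler_pdivlMr// mul1r (le_trans (ltW t1))//.
    (* All scales cost the same for d = 2, and K <= ln t / ln 4 of them are used: hence the
       logarithm. *)
    have [K /andP[K1 K2]] := exp_bracket (b := 4) isT t1.
    apply: (pt K) => //; rewrite /diffusive -/N.
    have -> : scale_sum d R K = K%:R by rewrite d2 scale_sum2.
    have -> : d%:R = 2 :> R by rewrite d2.
    have -> : 2 ^+ (K * d) = 4 ^+ K :> R.
      by rewrite d2 mulnC exprM; congr (_ ^+ _); ring.
    have lK : K%:R <= ln_plus t / ln 4%:R.
      rewrite ler_pdivlMr// mulr_natl -lnXn ?ltr0n//.
      by rewrite le_max; apply/orP; right; rewrite ler_ln ?posrE ?exprn_gt0.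
    move: lK K1 K2; set p : R := 4 ^+ K; set l := ln_plus t in lp *.
    set i := (ln 4%:R)^-1 in i4 *; move=> lK K1 K2.
    have p0 : 0 < p by rewrite exprn_gt0.
    have it : 0 <= t^-1 by rewrite invr_ge0 ltW.
    have a1 : 64 * 2 ^+ 2 * K%:R * N / t <= 256 * i * N * (l / t).
      have : K%:R * (N / t) <= l * i * (N / t) by rewrite ler_wpM2r// mulr_ge0.
      lra.
    have a2 : 8 * (N / p) <= 32 * N * (l / t).
      have : N / p <= 4 * N / t.
        rewrite ler_pdivrMr// mulrAC ler_pdivlMr//.
        have : N * t <= N * (4 * p) by rewrite ler_wpM2l// ltW// -exprS.
        lra.
      have : N / t * 1 <= N / t * l by rewrite ler_wpM2l// mulr_ge0.
      lra.
    have a3 : (256 * i + 32) * (N * (l / t)) <= C * (N * (l / t)).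
      rewrite ler_wpM2r//; last first.
        by have := exprn_ge0 2 (ler0n R d); rewrite /C -/i; lra.
      by rewrite !mulr_ge0//; lra.
    lra.
  (* The sum over scales is bounded, so K is only chosen large enough for the remainder to be at
     most 8 N / t. *)
  + have [K tK] : exists K, t <= 2 ^+ K.
      exists (Num.truncn t).+1; rewrite (le_trans (ltW (truncnS_gt _)))//.
      by rewrite -natrX ler_nat ltnW// ltn_expl.
    apply: (pt K) => //; rewrite /diffusive -/N.
    have sK := @scale_sum3 R d K d3.
    have it : 0 <= t^-1 by rewrite invr_ge0 ltW.
    have a1 : 64 * d%:R ^+ 2 * scale_sum d R K * N / t <= 128 * d%:R ^+ 2 * (N / t).
      have : d%:R ^+ 2 * (N / t) * scale_sum d R K <= d%:R ^+ 2 * (N / t) * 2.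
        by rewrite ler_wpM2l// !mulr_ge0.
      lra.
    have a2 : 8 * (N / 2 ^+ (K * d)) <= 8 * (N / t).
      rewrite ler_wpM2l// ler_wpM2l// lef_pV2 ?posrE ?exprn_gt0//.
      apply: (le_trans tK); rewrite ler_weXn2l ?ler1n//.
      by rewrite leq_pmulr.
    have a3 : (128 * d%:R ^+ 2 + 8) * (N / t) <= C * (N / t).
      rewrite ler_wpM2r ?mulr_ge0// /C.
      have : 0 < 256 / ln 4%:R :> R by rewrite mulr_gt0.
      lra.
    lra.
- apply: (@le_trans _ _ (\int[lebesgue_measure]_(t in [set t : R | (0 <= t)%R])
      energy_limit d_ge1 P_invariant mf Nf t)%E).
    apply: ge0_outer_le_integral.
    + rewrite (_ : [set t | _] = `[0, +oo[%classic); first exact: measurable_itv.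
      by apply/seteqP; split=> t /=; rewrite in_itv/= andbT.
    + by apply: measurable_funTS; exact: measurable_energy_limit.
    + move=> t _; apply: integral_ge0 => o _; exact: sqre_ge0.
    + by move=> t _; exact: energy_limit_ge0.
    + by apply/aeW => t t0; exact: sg.
  apply: integral_halfline_le => [|t|tau tau0].
  + exact: measurable_energy_limit.
  + exact: energy_limit_ge0.
  (* K depends on tau, but the bound does not: the sum over scales is at most 2 for d >= 3, and the
     remainder tau * 8 N / 2^(Kd) is at most 8 N. *)
  have [K tK] : exists K, tau <= 2 ^+ K.
    exists (Num.truncn tau).+1; rewrite (le_trans (ltW (truncnS_gt _)))//.
    by rewrite -natrX ler_nat ltnW// ltn_expl.
  apply: (le_trans (integral_energy_limit_le d_ge1 P_invariant P_ge1 mf Nf K tau0)).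
  rewrite /diffusive -/N NE -EFinM lee_fin.
  have sK := @scale_sum3 R d K d3.
  have a1 : 64 * d%:R ^+ 2 * scale_sum d R K * N <= 128 * d%:R ^+ 2 * N.
    have : d%:R ^+ 2 * N * scale_sum d R K <= d%:R ^+ 2 * N * 2.
      by rewrite ler_wpM2l// !mulr_ge0.
    lra.
  have a2 : tau * (8 * (N / 2 ^+ (K * d))) <= 8 * N.
    rewrite mulrCA ler_pM2l// mulrA ler_pdivrMr ?exprn_gt0// mulrC ler_wpM2l//.
    apply: (le_trans tK); rewrite ler_weXn2l ?ler1n//.
    by rewrite leq_pmulr.
  have a3 : (128 * d%:R ^+ 2 + 8) * N <= C * N.
    rewrite ler_wpM2r// /C.
    have : 0 < 256 / ln 4%:R :> R by rewrite mulr_gt0.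
    lra.
  lra.
Qed.
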